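(* Let the Hamiltonians satisfy (H), let $F$ satisfy (F), let $u_0$ be Lipschitz continuous, and let $(U_i^{\alpha,n})$ be the solution of the scheme (S). Let $m^0=\inf_{\beta,i}W_i^{\beta,0}$ and assume $m^0$ is finite. Define $\underline p_\alpha=\pi_\alpha^-(-m^0)$ if $-m^0>A_\alpha$ and $\underline p_\alpha=\pi_\alpha^-(-m^0+1)$ if $-m^0=A_\alpha$; $\overline p_\alpha=\pi_\alpha^+(-m^0)$ if $-m^0>A_\alpha$ and $\overline p_\alpha=\pi_\alpha^+(-m^0+1)$ if $-m^0=A_\alpha$; $\underline p^0_\alpha=\underline p_\alpha(-m^0)$ if $\underline p_\alpha(-m^0)<\overline p_\alpha$ and $\underline p^0_\alpha=\underline p_\alpha(-m^0+1)$ otherwise. Assume the CFL condition (CFLr) holds with these numbers. Then for every $n\ge0$: (i) $\underline p_\alpha\le p_{i,+}^{\alpha,n}\le\overline p_\alpha$ for all $i\ge1$, $\alpha=1,\dots,N$, and $\underline p^0_\alpha\le p_{0,+}^{\alpha,n}\le\overline p_\alpha$ for all $\alpha$; (ii) $m^0\le m^n\le m^{n+1}\le M^{n+1}\le M^n\le M^0$.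
   Context: Junction: $N\ge1$, $J=\bigcup_{\alpha=1}^N J_\alpha$, $N$ copies of $[0,+\infty)$ glued at $0$; points of $J_\alpha$ are identified with their coordinate $x\ge0$. Hamiltonians (H): $H_\alpha:\mathbb R\to\mathbb R$, $\alpha=1,\dots,N$, are Lipschitz continuous, coercive ($H_\alpha(p)\to+\infty$ as $|p|\to\infty$) and quasi-convex (sublevel sets convex). There is $p_0^\alpha$ with $H_\alpha$ non-increasing on $(-\infty,p_0^\alpha]$ and non-decreasing on $[p_0^\alpha,\infty)$; $H_\alpha^-(p)=H_\alpha(\min(p,p_0^\alpha))$, $H_\alpha^+(p)=H_\alpha(\max(p,p_0^\alpha))$; $A_\alpha=\min_{\mathbb R}H_\alpha$. Junction function (F): $F:\mathbb R^N\to\mathbb R$ is piecewise $C^1$, strictly decreasing in each variable $p_\alpha$, and $F(p)\to+\infty$ as $(p_1)_-+\dots+(p_N)_-\to+\infty$ ($r_-=\max(-r,0)$). $(-\nabla\cdot F)(p)=-\sum_\beta\partial_{p_\beta}F(p)$. Generalized inverses: $\pi_\alpha^+(a)=\sup\{p:H_\alpha^+(p)=\max(a,A_\alpha)\}$, $\pi_\alpha^-(a)=\inf\{p:H_\alpha^-(p)=\max(a,A_\alpha)\}$. By (F), for every $K\in\mathbb R$ there is $\underline p(K)=(\underline p_1(K),\dots,\underline p_N(K))\in\mathbb R^N$ such that $F(p)\le K$ implies $p_\alpha\ge\underline p_\alpha(K)$ for all $\alpha$; such a choice is fixed with each $K\mapsto\underline p_\alpha(K)$ non-increasing. Scheme (S):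 for $\Delta t,\Delta x>0$, unknowns $U_i^{\alpha,n}$ ($i,n\in\mathbb N$, $\alpha=1,\dots,N$) with $U_0^{\alpha,n}=U_0^n$ for all $\alpha$; $p_{i,+}^{\alpha,n}=(U_{i+1}^{\alpha,n}-U_i^{\alpha,n})/\Delta x$, $p_{i,-}^{\alpha,n}=(U_i^{\alpha,n}-U_{i-1}^{\alpha,n})/\Delta x$; for $n\ge0$: $\frac{U_i^{\alpha,n+1}-U_i^{\alpha,n}}{\Delta t}+\max\{H_\alpha^+(p_{i,-}^{\alpha,n}),H_\alpha^-(p_{i,+}^{\alpha,n})\}=0$ for $i\ge1$; $\frac{U_0^{n+1}-U_0^n}{\Delta t}+F(p_{0,+}^{1,n},\dots,p_{0,+}^{N,n})=0$; $U_i^{\alpha,0}=u_0(i\Delta x\in J_\alpha)$. Discrete time derivative $W_i^{\alpha,n}=(U_i^{\alpha,n+1}-U_i^{\alpha,n})/\Delta t$ (with $W_0^{\alpha,n}=W_0^n$ common), $m^n=\inf_{\alpha,i}W_i^{\alpha,n}$, $M^n=\sup_{\alpha,i}W_i^{\alpha,n}$. CFL condition (CFLr): $\frac{\Delta x}{\Delta t}\ge\max\Big\{\max_\alpha\sup_{p\in[\underline p_\alpha,\overline p_\alpha]}|H_\alpha'(p)|,\ \sup_{p\in\prod_\alpha[\underline p^0_\alpha,\overline p_\alpha]}(-\nabla\cdot F)(p)\Big\}$ (derivatives a.e.). *)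

(* Defs.v *)
From Stdlib Require Import Reals Lra ClassicalEpsilon Classical Arith.
Open Scope R_scope.

(* ---------- generic sup / inf of a set of reals (0 if undefined) ---------- *)
Definition Rsup (E : R -> Prop) : R :=
  match excluded_middle_informative (exists l, is_lub E l) with
  | left h => proj1_sig (constructive_indefinite_description _ h)
  | right _ => 0
  end.
Definition Rinf (E : R -> Prop) : R := - Rsup (fun x => E (- x)).

(* ---------- vectors of R^N, represented as nat -> R (coordinates 0..N-1) ---------- *)
Fixpoint sumN (N : nat) (f : nat -> R) : R :=
  match N with O => 0 | S k => sumN k f + f k end.

Definition upd (p : nat -> R) (b : nat) (t : R) : nat -> R :=
  fun g => if Nat.eq_dec g b then t else p g.

Definition negpart (r : R) : R := Rmax (- r) 0.

Definition depends_only (N : nat) (G : (nat -> R) -> R) : Prop :=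
  forall p q, (forall b, (b < N)%nat -> p b = q b) -> G p = G q.

Definition continuous_N (N : nat) (G : (nat -> R) -> R) : Prop :=
  forall p eps, 0 < eps -> exists delta, 0 < delta /\
    forall q, (forall b, (b < N)%nat -> Rabs (q b - p b) < delta) ->
      Rabs (G q - G p) < eps.

Definition C1N (N : nat) (G : (nat -> R) -> R) : Prop :=
  forall b, (b < N)%nat -> exists dG : (nat -> R) -> R,
    (forall p, derivable_pt_lim (fun t => G (upd p b t)) (p b) (dG p)) /\
    continuous_N N dG.

Definition piecewise_C1 (N : nat) (F : (nat -> R) -> R) : Prop :=
  continuous_N N F /\
  exists (K : nat) (Fk : nat -> (nat -> R) -> R),
    (forall k, (k < K)%nat -> depends_only N (Fk k) /\ C1N N (Fk k)) /\
    (forall p, exists k, (k < K)%nat /\ F p = Fk k p).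

Definition hyp_H (H : R -> R) (p0 : R) : Prop :=
  (exists L, forall p q, Rabs (H p - H q) <= L * Rabs (p - q)) /\
  (forall K, exists r, forall p, r < Rabs p -> K < H p) /\
  (forall K x y t, 0 <= t <= 1 -> H x <= K -> H y <= K ->
      H (t * x + (1 - t) * y) <= K) /\
  (forall p q, p <= q <= p0 -> H q <= H p) /\
  (forall p q, p0 <= p <= q -> H p <= H q).

Definition Hplus (H : nat -> R -> R) (p0 : nat -> R) (a : nat) (p : R) : R :=
  H a (Rmax p (p0 a)).
Definition Hminus (H : nat -> R -> R) (p0 : nat -> R) (a : nat) (p : R) : R :=
  H a (Rmin p (p0 a)).
Definition Amin (H : nat -> R -> R) (a : nat) : R :=
  Rinf (fun y => exists p, y = H a p).

Definition pi_plus (H : nat -> R -> R) (p0 : nat -> R) (a : nat) (c : R) : R :=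
  Rsup (fun p => Hplus H p0 a p = Rmax c (Amin H a)).
Definition pi_minus (H : nat -> R -> R) (p0 : nat -> R) (a : nat) (c : R) : R :=
  Rinf (fun p => Hminus H p0 a p = Rmax c (Amin H a)).

Definition hyp_F (N : nat) (F : (nat -> R) -> R) : Prop :=
  depends_only N F /\
  piecewise_C1 N F /\
  (forall p b s t, (b < N)%nat -> s < t -> F (upd p b t) < F (upd p b s)) /\
  (forall K, exists r, forall p, r < sumN N (fun b => negpart (p b)) -> K < F p).

Definition hyp_pK (N : nat) (F : (nat -> R) -> R) (pK : R -> nat -> R) : Prop :=
  (forall K p, F p <= K -> forall a, (a < N)%nat -> pK K a <= p a) /\
  (forall K1 K2 a, K1 <= K2 -> pK K2 a <= pK K1 a).

(* u0 a x = value at the point x of branch J_a (branches numbered 0..N-1) *)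
Definition distJ (a b : nat) (x y : R) : R :=
  if Nat.eq_dec a b then Rabs (x - y) else x + y.
Definition lipschitz_J (N : nat) (u0 : nat -> R -> R) : Prop :=
  exists L, forall a b x y, (a < N)%nat -> (b < N)%nat -> 0 <= x -> 0 <= y ->
    Rabs (u0 a x - u0 b y) <= L * distJ a b x y.

Section Scheme.
Variables (H : nat -> R -> R) (p0 : nat -> R) (F : (nat -> R) -> R)
          (u0 : nat -> R -> R) (dt dx : R).

(* U n a i = U_i^{a,n};  the junction value U_0^n is U n a 0 (the same for all a) *)
Fixpoint U (n : nat) : nat -> nat -> R :=
  match n with
  | O => fun a i => u0 a (INR i * dx)
  | S m =>
    let V := U m in
    fun a i =>
      match i with
      | O => V 0%nat 0%nat - dt * F (fun b => (V b 1%nat - V b 0%nat) / dx)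
      | S k => V a i - dt * Rmax (Hplus H p0 a ((V a i - V a k) / dx))
                                 (Hminus H p0 a ((V a (S i) - V a i) / dx))
      end
  end.

Definition pplus (n a i : nat) : R := (U n a (S i) - U n a i) / dx.
Definition Wd (n a i : nat) : R := (U (S n) a i - U n a i) / dt.
Definition Wset (N n : nat) (y : R) : Prop :=
  exists a i, (a < N)%nat /\ y = Wd n a i.
Definition mn (N n : nat) : R := Rinf (Wset N n).
Definition Mn (N n : nat) : R := Rsup (Wset N n).

Definition p_low (N : nat) (a : nat) : R :=
  if Rlt_dec (Amin H a) (- mn N 0) then pi_minus H p0 a (- mn N 0)
  else pi_minus H p0 a (- mn N 0 + 1).
Definition p_up (N : nat) (a : nat) : R :=
  if Rlt_dec (Amin H a) (- mn N 0) then pi_plus H p0 a (- mn N 0)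
  else pi_plus H p0 a (- mn N 0 + 1).
Definition p_low0 (pK : R -> nat -> R) (N : nat) (a : nat) : R :=
  if Rlt_dec (pK (- mn N 0) a) (p_up N a) then pK (- mn N 0) a
  else pK (- mn N 0 + 1) a.

(* CFL condition (CFLr); derivatives "a.e." read as: at every point where they exist *)
Definition CFLr (pK : R -> nat -> R) (N : nat) : Prop :=
  (forall a p d, (a < N)%nat -> p_low N a <= p <= p_up N a ->
     derivable_pt_lim (H a) p d -> Rabs d <= dx / dt) /\
  (forall (p dF : nat -> R),
     (forall b, (b < N)%nat -> p_low0 pK N b <= p b <= p_up N b) ->
     (forall b, (b < N)%nat -> derivable_pt_lim (fun t => F (upd p b t)) (p b) (dF b)) ->
     - sumN N dF <= dx / dt).
End Scheme.

(* Main.v *)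
(* With [c = - m^0] and [Lam = dx / dt], the gradient bounds follow from [m^n >= m^0] because then
   [H_a^+(p_{i,+}) <= c] for [i >= 0], [H_a^-(p_{i,+}) <= c] for [i >= 1] and [F(p_{0,+}) <= c].
   The monotonicity of [m^n] and [M^n] rests on the following consequence of the CFL condition
   for each of the three functions (for [F], along the diagonal): if [f p + Lam s <= c], then
   moving [p] by [s] in the increasing direction raises [f] by at most [Lam s]; the level [c]
   keeps the whole segment inside the region where the CFL condition is assumed.

   As the CFL condition only concerns points of differentiability, two arguments are needed to
   integrate it.  A Lipschitz nondecreasing function on the line has a Lebesgue-Stieltjes measure
   dominated by the Lebesgue measure, so by Radon-Nikodym and the Lebesgue differentiation theorem
   it is the integral of its derivative.  For [F], the set of points where one of its finitely many
   C1 pieces is active and satisfies the slope bound is closed, and it is dense in the open box by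
   Baire's theorem applied to the sets [F = F_k]; hence every point has such a piece, and this
   bounds the one-sided slopes along each diagonal. *)
Require Import Defs.
From Stdlib Require Import Reals Lra Lia Arith ClassicalEpsilon Classical FunctionalExtensionality.
From HB Require structures.
From mathcomp Require all_boot all_order all_algebra all_classical all_reals all_analysis.
From mathcomp Require ring lra Rstruct Rstruct_topology.
Open Scope R_scope.

(** * Lipschitz functions with bounded derivative *)

Module BoundedSlope.
Import structures all_boot all_order all_algebra all_classical all_reals all_analysis.
Import ring lra Rstruct Rstruct_topology.
Import Order.TTheory GRing.Theory Num.Theory numFieldNormedType.Exports.
Set Implicit Arguments. Unset Strict Implicit. Unset Printing Implicit Defensive.
Local Open Scope classical_set_scope.
Local Open Scope ring_scope.

Definition cumulative_of (R : realType) (f : R -> R)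
    (nd : nondecreasing f) (cf : continuous f) : cumulative R R :=
  HB.pack f (isCumulative.Build R _ R f nd (right_continuousW cf)).

Lemma lebesgue_stieltjes_oc (R : realType) (f : cumulative R R) (a b : R) :
  a <= b ->
  lebesgue_stieltjes_measure f (`]a, b]%classic : set (measurableTypeR R)) = (f b - f a)%:E.
Proof.
move=> ab.
rewrite /lebesgue_stieltjes_measure /measure_extension measurable_mu_extE/=; last exact: is_ocitv.
by rewrite wlength_itv_bnd.
Qed.

Lemma lipschitz1_continuous (R : realType) (f : R -> R) :
  nondecreasing f -> (forall x y, x <= y -> f y - f x <= y - x) -> continuous f.
Proof.
move=> nd lf x; apply/cvgrPdist_le => e e0; near=> y.
apply: (@le_trans _ _ `|x - y|); last first.
  by near: y; apply: cvgr_dist_le.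
have [xy|/ltW yx] := leP x y.
  rewrite distrC (distrC x) !ger0_norm ?subr_ge0 ?lf//; exact: nd.
by rewrite !ger0_norm ?subr_ge0 ?lf//; exact: nd.
Unshelve. all: end_near. Qed.

(** Since [x - f x] is nondecreasing as well, the Lebesgue measure is the sum of the Stieltjes
    measures of [f] and of [x - f x]: the two sides agree on half-open intervals, which determine
    the Lebesgue measure. Dropping the second summand gives the inequality. *)
Lemma lebesgue_stieltjes_le_lebesgue (R : realType) (f : cumulative R R) :
  (forall x y, x <= y -> f y - f x <= y - x) ->
  forall A : set (measurableTypeR R), measurable A ->
  (lebesgue_stieltjes_measure f A <= lebesgue_measure A)%E.
Proof.
move=> lf A mA.
have ndg : nondecreasing (fun x => x - f x).
  by move=> x y xy; have := lf _ _ xy; lra.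
have cf : continuous f.
  apply: lipschitz1_continuous => //; exact: cumulative_is_nondecreasing.
have cg : continuous (fun x => x - f x).
  by move=> x; apply: cvgB => //; exact: cf.
pose g := cumulative_of ndg cg.
have -> : lebesgue_measure A =
    measure_add (lebesgue_stieltjes_measure f) (lebesgue_stieltjes_measure g) A.
  apply: lebesgue_measure_unique => // X [[u v] _ <-].
  apply: etrans (esym (measure_addE _ _ _)); have [uv|vu] := leP u v.
    apply: etrans (lebesgue_stieltjes_oc _ uv) _ => /=.
    apply: etrans (esym (congr2 adde (lebesgue_stieltjes_oc f uv)
      (lebesgue_stieltjes_oc g uv))); rewrite /=; congr EFin.
    ring.
  by rewrite !set_itv_ge ?bnd_simp -?leNgt ?(ltW vu)// !measure0 adde0.
by rewrite measure_addE leeDl.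
Qed.

Lemma increment_le_derive_bound (R : realType) (f : R -> R) (L a b : R) :
  nondecreasing f -> (forall x y, x <= y -> f y - f x <= y - x) ->
  0 <= L -> a <= b ->
  (forall x d, a < x <= b -> is_derive x 1 f d -> d <= L) ->
  f b - f a <= L * (b - a).
Proof.
move=> nd lf L0 ab fL.
pose mu := @lebesgue_measure R.
pose F := cumulative_of nd (lipschitz1_continuous nd lf).
(* The enlarged interval makes [b] an interior point, where the integral can be differentiated. *)
pose D : set (measurableTypeR R) := `]a - 1, b + 1]%classic.
have mD : measurable D by exact: measurable_itv.
(* Restricting to the bounded interval [D] makes the Stieltjes measure finite, so that its density
   is integrable over the whole line. *)
have muD : (lebesgue_stieltjes_measure F D < +oo)%E.
  by rewrite lebesgue_stieltjes_oc ?ltry//; lra.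
pose nu : {finite_measure set (measurableTypeR R) -> \bar R} := mfrestr mD muD.
have nuE u v : a - 1 <= u -> u <= v -> v <= b + 1 ->
    nu `]u, v]%classic = (f v - f u)%:E.
  move=> au uv vb.
  rewrite -(@lebesgue_stieltjes_oc _ F u v)//=.
  rewrite /nu /= /mfrestr /mrestr /= setIidl//.
  by apply: subset_itv; rewrite bnd_simp.
have numu : nu `<< mu.
  apply/null_content_dominatesP => A mA muA.
  apply/eqP; rewrite eq_le measure_ge0 andbT -muA.
  rewrite /nu /= /mfrestr /mrestr /=.
  apply: (@le_trans _ _ (lebesgue_stieltjes_measure F A)).
    by apply: measureIl.
  exact: lebesgue_stieltjes_le_lebesgue.
(* The density [h] has extended real values but is finite everywhere; [g] is its real version. *)
pose h := Radon_Nikodym_SigmaFinite.f nu mu.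
pose g x := fine (h x).
have gh : EFin \o g = h.
  by apply/funext => x /=; rewrite fineK//; exact: Radon_Nikodym_SigmaFinite.f_fin_num.
have g0 x : 0 <= g x.
  by apply: fine_ge0; exact: Radon_Nikodym_SigmaFinite.f_ge0.
have intg : mu.-integrable setT (EFin \o g).
  by rewrite gh; exact: Radon_Nikodym_SigmaFinite.f_integrable.
have fg u v : a - 1 <= u -> u <= v -> v <= b + 1 ->
    (f v - f u)%:E = (\int[mu]_(x in `]u, v]%classic) (g x)%:E)%E.
  move=> au uv vb; rewrite -nuE// (Radon_Nikodym_SigmaFinite.f_integral numu)//.
  by rewrite -/h -gh.
(* At almost every point the primitive [G] of [g] is differentiable with derivative [g x]. Near such
   a point [f] equals [G] up to the constant [f (a - 1)], so [g x] is a derivative of [f] and the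
   assumed bound applies to it. *)
have gL : {ae mu, forall x, `]a, b]%classic x -> ((g x)%:E <= L%:E)%E}.
  have := @FTC1 R g (BRight (a - 1)) _ _.
  have intgy y : mu.-integrable [set` Interval (BRight (a - 1)) (BRight y)] (EFin \o g).
    exact: integrableS intg.
  have locg : locally_integrable [set: R] g.
    by apply: open_integrable_locally => //; exact: openT.
  move=> /(_ intgy locg); apply: filterS; first exact: (ae_filter_ringOfSetsType mu).
  move=> x.
  set G := (fun y => _) => + /=; rewrite in_itv/= => + /andP[ax xb].
  case; first by rewrite lte_fin; lra.
  move=> dG Gx.
  have Gf : \forall y \near x, f y = G y + f (a - 1).
    near=> y.
    have yab : a - 1 < y < b + 1.
      by apply/andP; split; near: y; [apply: lt_nbhsr|apply: lt_nbhsl]; lra.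
    rewrite /G /Rintegral -fg; [by rewrite /= subrK| | |]; lra.
  rewrite lee_fin; apply: (fL x); first by rewrite ax.
  have GxE : is_derive x 1 (G + cst (f (a - 1))) (g x).
    rewrite -[g x]addr0; apply: is_deriveD.
    by rewrite -Gx derive1E; exact: derivableP.
  by apply: near_eq_is_derive GxE; near do apply/esym.
have : ((f b - f a)%:E <= (L * (b - a))%:E)%E.
  rewrite fg; [|lra..].
  have -> : (L * (b - a))%:E = (\int[mu]_(x in `]a, b]%classic) L%:E)%E.
    by rewrite integral_cst// EFinM; congr (_ * _)%E; rewrite -(lebesgue_stieltjes_oc idfun ab).
  apply: ae_ge0_le_integral => //.
  - by move=> x _; rewrite lee_fin.
  - exact: measurable_funS (measurable_int _ intg).
by rewrite lee_fin.
Unshelve. all: end_near. Qed.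

Lemma derivable_pt_lim_increment (f : Rdefinitions.R -> Rdefinitions.R)
    (L a b : Rdefinitions.R) :
  (forall x y, Rle x y -> Rle (f x) (f y) /\ Rle (Rminus (f y) (f x)) (Rminus y x)) ->
  Rle (IZR 0) L -> Rle a b ->
  (forall x d, Rlt a x -> Rle x b -> derivable_pt_lim f x d -> Rle d L) ->
  Rle (Rminus (f b) (f a)) (Rmult L (Rminus b a)).
Proof.
move=> lf /RleP L0 /RleP ab fL; apply/RleP.
apply: increment_le_derive_bound => //.
- by move=> x y /RleP xy; apply/RleP; have [] := lf x y xy.
- by move=> x y /RleP xy; apply/RleP; have [] := lf x y xy.
move=> x d /andP[/RltP ax /RleP xb] fxd; apply/RleP; apply: (fL x) => //.
case: fxd => dfx dE e /RltP e0.
have /cvg_ex[l fl] := dfx.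
have ld : l = d by rewrite -dE; apply/esym/cvg_lim.
move: fl; rewrite ld => /cvgrPdist_lt /(_ _ e0) [dl /= dl0 H].
exists (mkposreal _ (RltP dl0)) => h h0 /RltP hd.
have {}h0 : h != 0 by apply/eqP.
have := H h; rewrite /= sub0r normrN => /(_ hd h0) /RltP.
congr (Rlt _ _); rewrite RabsE distrC RminusE RdivE; congr `|_ - _|.
by rewrite [RHS]mulrC RplusE [in RHS]addrC /GRing.scale/= mulr1.
Qed.
End BoundedSlope.

(** * Suprema and infima of sets of reals *)

Lemma Rsup_ub (E : R -> Prop) (B x : R) :
  (forall y, E y -> y <= B) -> E x -> x <= Rsup E.
Proof.
  intros HB Hx. unfold Rsup.
  destruct (excluded_middle_informative _) as [h|h].
  - destruct (constructive_indefinite_description _ h) as [l Hl]; simpl. now apply (proj1 Hl).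
  - exfalso; apply h. destruct (completeness E) as [l Hl]; [now exists B|now exists x|now exists l].
Qed.

Lemma Rsup_le (E : R -> Prop) (B x : R) :
  E x -> (forall y, E y -> y <= B) -> Rsup E <= B.
Proof.
  intros Hx HB. unfold Rsup.
  destruct (excluded_middle_informative _) as [h|h].
  - destruct (constructive_indefinite_description _ h) as [l Hl]; simpl. now apply (proj2 Hl).
  - exfalso; apply h. destruct (completeness E) as [l Hl]; [now exists B|now exists x|now exists l].
Qed.

Lemma Rinf_lb (E : R -> Prop) (B x : R) :
  (forall y, E y -> B <= y) -> E x -> Rinf E <= x.
Proof.
  intros HB Hx. unfold Rinf.
  enough (- x <= Rsup (fun y => E (- y))) by lra.
  apply Rsup_ub with (- B).
  - intros y Hy. apply HB in Hy. lra.
  - now rewrite Ropp_involutive.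
Qed.

Lemma Rinf_ge (E : R -> Prop) (B x : R) :
  E x -> (forall y, E y -> B <= y) -> B <= Rinf E.
Proof.
  intros Hx HB. unfold Rinf.
  enough (Rsup (fun y => E (- y)) <= - B) by lra.
  apply Rsup_le with (- x).
  - now rewrite Ropp_involutive.
  - intros y Hy. apply HB in Hy. lra.
Qed.

(** Dividing [f] by [K], the maximum of its Lipschitz constant and 1, reduces to a function whose
    increments are at most those of the variable. The 1 keeps [K] positive for every [M]. *)
Lemma increment_le_of_derivative_le (f : R -> R) (M L a b : R) :
  (forall x y, x <= y -> f x <= f y) ->
  (forall x y, Rabs (f x - f y) <= M * Rabs (x - y)) ->
  0 <= L -> a <= b ->
  (forall x d, a < x <= b -> derivable_pt_lim f x d -> d <= L) ->
  f b - f a <= L * (b - a).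
Proof.
  intros Hmono Hlip HL Hab Hder.
  set (K := Rmax M 1).
  assert (HK : 1 <= K) by apply Rmax_r.
  assert (HMK : M <= K) by apply Rmax_l.
  assert (Hdiv : forall u v, u / K <= v -> u <= v * K).
  { intros u v Huv. replace u with (u / K * K) by (field; lra).
    apply Rmult_le_compat_r; lra. }
  assert (HiK : 0 < / K) by (apply Rinv_0_lt_compat; lra).
  enough (f b / K - f a / K <= L / K * (b - a)) as Hscaled.
  { replace (f b / K - f a / K) with ((f b - f a) / K) in Hscaled by (field; lra).
    apply Hdiv in Hscaled.
    now replace (L / K * (b - a) * K) with (L * (b - a)) in Hscaled by (field; lra). }
  apply (BoundedSlope.derivable_pt_lim_increment (f := fun x => f x / K)).
  - intros x y Hxy. split.
    + apply Rmult_le_compat_r; [lra|now apply Hmono].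
    + replace (f y / K - f x / K) with ((f y - f x) * / K) by (field; lra).
      replace (y - x) with ((y - x) * K * / K) by (field; lra).
      apply Rmult_le_compat_r; [lra|].
      pose proof (Hlip y x) as Hl. rewrite (Rabs_pos_eq (y - x)) in Hl by lra.
      pose proof (Rle_abs (f y - f x)). nra.
  - unfold Rdiv. nra.
  - exact Hab.
  - intros x d Hax Hxb Hd.
    assert (derivable_pt_lim f x (d * K)) as HdK.
    { replace f with (mult_real_fct K (fun x => f x / K)).
      - rewrite (Rmult_comm d). now apply derivable_pt_lim_scal.
      - apply functional_extensionality; intros z. unfold mult_real_fct. field; lra. }
    apply Hder in HdK; [|lra].
    replace d with (d * K * / K) by (field; lra). unfold Rdiv.
    apply Rmult_le_compat_r; lra.
Qed.

(** * Intermediate values, locality of the derivative and right slopes *)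

Lemma lipschitz_continuity (f : R -> R) (M : R) :
  (forall x y, Rabs (f x - f y) <= M * Rabs (x - y)) -> continuity f.
Proof.
  intros Hlip x eps Heps.
  exists (eps / (Rmax M 1)).
  assert (1 <= Rmax M 1) by apply Rmax_r.
  assert (M <= Rmax M 1) by apply Rmax_l.
  split; [apply Rdiv_lt_0_compat; lra|].
  intros y [_ Hy]. simpl in *. unfold Rdist in *.
  apply Rle_lt_trans with (Rmax M 1 * Rabs (y - x)).
  - apply Rle_trans with (M * Rabs (y - x)); [apply Hlip|].
    apply Rmult_le_compat_r; [apply Rabs_pos|lra].
  - replace eps with (Rmax M 1 * (eps / Rmax M 1)) by (field; lra).
    apply Rmult_lt_compat_l; lra.
Qed.

Lemma continuous_attains (f : R -> R) (a b y : R) :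
  continuity f -> a <= b -> f a <= y -> y <= f b -> exists x, a <= x <= b /\ f x = y.
Proof.
  intros Hc Hab Ha Hb.
  destruct (IVT_cor (fun x => f x - y) a b) as [x [Hx Hy]].
  - apply continuity_minus; [exact Hc|]. apply continuity_const. now intros u v.
  - exact Hab.
  - nra.
  - exists x. split; [exact Hx|lra].
Qed.

Lemma derivable_pt_lim_local (f g : R -> R) (x d r : R) :
  0 < r -> (forall y, Rabs (y - x) < r -> f y = g y) ->
  derivable_pt_lim f x d -> derivable_pt_lim g x d.
Proof.
  intros Hr Hfg Hd eps Heps.
  destruct (Hd eps Heps) as [[delta Hdelta] Hlim]; simpl in Hlim.
  assert (Hm : 0 < Rmin delta r) by now apply Rmin_pos.
  exists (mkposreal _ Hm); intros h Hh Hhm; simpl in Hhm.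
  rewrite <- !Hfg.
  - apply Hlim; [exact Hh|]. eapply Rlt_le_trans; [exact Hhm|apply Rmin_l].
  - rewrite Rminus_diag, Rabs_R0. exact Hr.
  - replace (x + h - x) with h by ring. eapply Rlt_le_trans; [exact Hhm|apply Rmin_r].
Qed.

(** Let [c] be the supremum of the points of [0, S] where [g <= 0]. Continuity gives [g c <= 0], and
    if [c < S] the slope bound to the right of [c] yields a larger such point. *)
Lemma le_of_right_slope_le (f : R -> R) (L S : R) :
  0 <= S -> continuity f ->
  (forall s, 0 <= s < S -> exists delta, 0 < delta /\
     forall t, s <= t < s + delta -> f t <= f s + L * (t - s)) ->
  f S <= f 0 + L * S.
Proof.
  intros HS Hc Hslope.
  set (g := fun s => f s - f 0 - L * s).
  assert (Hg : continuity g).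
  { unfold g. intros x. reg. }
  set (E := fun s => 0 <= s <= S /\ g s <= 0).
  assert (HE0 : E 0) by (unfold E, g; lra).
  destruct (completeness E) as [c [Hub Hlub]].
  { exists S. intros s [Hs _]. lra. }
  { now exists 0. }
  assert (Hc0 : 0 <= c) by now apply Hub.
  assert (HcS : c <= S) by (apply Hlub; intros s [Hs _]; lra).
  assert (Hgc : g c <= 0).
  { apply Rnot_lt_le; intros Hpos.
    destruct (Hg c (g c) Hpos) as [delta [Hdelta Hd]]; simpl in Hd; unfold Rdist in Hd.
    enough (c <= c - delta) by lra.
    apply Hlub. intros s [Hs Hgs].
    apply Rnot_lt_le; intros Hlt.
    assert (s <= c) by (apply Hub; split; assumption).
    destruct (Req_dec c s) as [->|Hne]; [lra|].
    assert (Rabs (g s - g c) < g c) as Habs.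
    { apply Hd. split; [split; [exact I|exact Hne]|].
      rewrite Rabs_left1 by lra. lra. }
    apply Rabs_def2 in Habs. lra. }
  destruct (Req_dec c S) as [->|Hne]; [unfold g in Hgc; lra|].
  destruct (Hslope c) as [delta [Hdelta Hd]]; [lra|].
  set (t := Rmin S (c + delta / 2)).
  assert (Ht : c < t <= S /\ t < c + delta).
  { unfold t. repeat split; [apply Rmin_glb_lt; lra|apply Rmin_l|].
    eapply Rle_lt_trans; [apply Rmin_r|lra]. }
  assert (E t) as Het.
  { split; [lra|]. specialize (Hd t). unfold g in *. lra. }
  apply Hub in Het. lra.
Qed.

(** * Hamiltonians *)

(** Reflection exchanges the decreasing and the increasing branch, so every fact about [Hminus] is
    obtained from the corresponding fact about [h (Rmax x q)], the form of [Hplus]. *)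
Lemma hyp_H_opp (h : R -> R) (q : R) :
  hyp_H h q -> hyp_H (fun p => h (- p)) (- q).
Proof.
  intros ((L & HL) & Hcoe & Hqc & Hdec & Hinc). repeat split.
  - exists L. intros x y. rewrite <- (Rabs_Ropp (x - y)).
    replace (- (x - y)) with (- x - - y) by ring. apply HL.
  - intros K. destruct (Hcoe K) as [r Hr]. exists r. intros p Hp.
    apply Hr. now rewrite Rabs_Ropp.
  - intros K x y t Ht Hx Hy.
    replace (- (t * x + (1 - t) * y)) with (t * - x + (1 - t) * - y) by ring.
    now apply Hqc.
  - intros x y Hxy. apply Hinc. lra.
  - intros x y Hxy. apply Hdec. lra.
Qed.

Lemma clip_nondecreasing (h : R -> R) (q x y : R) :
  hyp_H h q -> x <= y -> h (Rmax x q) <= h (Rmax y q).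
Proof.
  intros (_ & _ & _ & _ & Hinc) Hxy. apply Hinc. split.
  - apply Rmax_r.
  - now apply Rle_max_compat_r.
Qed.

Lemma hyp_H_min (h : R -> R) (q p : R) : hyp_H h q -> h q <= h p.
Proof.
  intros (_ & _ & _ & Hdec & Hinc). destruct (Rle_dec p q); [apply Hdec|apply Hinc]; lra.
Qed.

Lemma clip_lipschitz (h : R -> R) (q : R) :
  hyp_H h q -> exists M, forall x y, Rabs (h (Rmax x q) - h (Rmax y q)) <= M * Rabs (x - y).
Proof.
  intros ((L & HL) & _). exists (Rabs L). intros x y.
  eapply Rle_trans; [apply HL|].
  eapply Rle_trans; [apply Rmult_le_compat_r; [apply Rabs_pos|apply Rle_abs]|].
  apply Rmult_le_compat_l; [apply Rabs_pos|].
  unfold Rmax, Rabs.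
  destruct (Rle_dec x q), (Rle_dec y q); repeat destruct (Rcase_abs _); lra.
Qed.

(** Coercivity bounds the level set above, and the intermediate value theorem provides a point of it
    beyond [x]. So [Rsup] is a true supremum here and not its default value 0. *)
Lemma le_level_sup (h : R -> R) (q c x : R) :
  hyp_H h q -> h (Rmax x q) <= c -> x <= Rsup (fun p => h (Rmax p q) = c).
Proof.
  intros Hh Hx.
  destruct (clip_lipschitz h q Hh) as [M HM].
  assert (Hcoe : forall K, exists r, forall p, r < p -> K < h (Rmax p q)).
  { intros K. destruct Hh as (_ & Hcoe & _). destruct (Hcoe K) as [r Hr].
    exists r. intros p Hp. apply Hr.
    pose proof (Rmax_l p q). pose proof (Rle_abs (Rmax p q)). lra. }
  destruct (Hcoe c) as [r Hr].
  assert (Hxr : x <= r + Rabs (x - r)) by (pose proof (Rle_abs (x - r)); lra).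
  (* The right endpoint exceeds both [x] and [r], so the level [c] has been passed there. *)
  destruct (continuous_attains (fun p => h (Rmax p q)) x (r + Rabs (x - r) + 1) c)
    as [z [Hz Hzc]].
  - now apply lipschitz_continuity with M.
  - lra.
  - exact Hx.
  - apply Rlt_le, Hr. pose proof (Rabs_pos (x - r)). lra.
  - apply Rle_trans with z; [lra|].
    apply Rsup_ub with r; [|exact Hzc].
    intros y Hy. apply Rnot_lt_le. intros Hlt. apply Hr in Hlt. lra.
Qed.

(** The derivative bound can be integrated as long as the level stays at most [c]. If the level [c]
    were exceeded, it would be attained at some [z] reached after a step shorter than [s];
    integrating up to [z] gives a value strictly below [h (Rmax p q) + Lam * s <= c], a
    contradiction. *)
Lemma clip_slope (h : R -> R) (q Lam c c' : R) :
  hyp_H h q -> 0 < Lam -> c <= c' ->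
  (forall p d, q <= p <= Rsup (fun p => h (Rmax p q) = c') ->
     derivable_pt_lim h p d -> d <= Lam) ->
  forall p s, 0 <= s -> h (Rmax p q) + Lam * s <= c ->
    h (Rmax (p + s) q) <= h (Rmax p q) + Lam * s.
Proof.
  intros Hh HLam Hcc Hder p s Hs Hps.
  destruct (clip_lipschitz h q Hh) as [M HM].
  assert (Hinc : forall x y, q <= x -> x <= y -> h (Rmax y q) <= c ->
            h (Rmax y q) - h (Rmax x q) <= Lam * (y - x)).
  { intros x y Hqx Hxy Hy.
    apply (increment_le_of_derivative_le (fun z => h (Rmax z q)) M); try lra.
    - intros u v Huv. now apply clip_nondecreasing.
    - exact HM.
    - intros z d Hz Hd. apply Hder with z.
      + split; [lra|]. apply Rle_trans with y; [lra|]. apply le_level_sup; [exact Hh|lra].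
      + apply derivable_pt_lim_local with (fun z => h (Rmax z q)) (z - q); [lra| |exact Hd].
        intros w Hw. apply Rabs_def2 in Hw. now rewrite Rmax_left by lra. }
  assert (Hidem : forall x, Rmax (Rmax x q) q = Rmax x q)
    by (intros x; apply Rmax_left, Rmax_r).
  (* Clipping both endpoints at [q] keeps the values and can only shorten the step. *)
  set (x := Rmax p q). set (y := Rmax (p + s) q).
  assert (Hxy : q <= x <= y) by (split; [apply Rmax_r|apply Rle_max_compat_r; lra]).
  assert (Hyx : y - x <= s).
  { unfold x, y, Rmax. destruct (Rle_dec p q), (Rle_dec (p + s) q); lra. }
  assert (Hx : h (Rmax x q) = h x) by (unfold x; now rewrite Hidem).
  assert (Hy : h (Rmax y q) = h y) by (unfold y; now rewrite Hidem).
  fold x in Hps.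
  destruct (Rle_lt_dec (h y) c) as [Hyc|Hyc].
  - pose proof (Hinc x y). nra.
  - exfalso.
    destruct (continuous_attains (fun z => h (Rmax z q)) x y c) as [z [Hz Hzc]]; try nra.
    + now apply lipschitz_continuity with M.
    + pose proof (Hinc x z).
      assert (z <> y) by (intros ->; lra).
      assert (z - x < s) by lra. nra.
Qed.

Lemma Ropp_Rmax_Ropp (x q : R) : - Rmax x (- q) = Rmin (- x) q.
Proof. unfold Rmax, Rmin. destruct (Rle_dec x (- q)), (Rle_dec (- x) q); lra. Qed.

Lemma Hminus_opp (H : nat -> R -> R) (p0 : nat -> R) (a : nat) (x : R) :
  Hminus H p0 a (- x) = H a (- Rmax x (- p0 a)).
Proof. unfold Hminus. now rewrite Ropp_Rmax_Ropp. Qed.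

Lemma pi_minus_opp (H : nat -> R -> R) (p0 : nat -> R) (a : nat) (c : R) :
  pi_minus H p0 a c = - Rsup (fun x => H a (- Rmax x (- p0 a)) = Rmax c (Amin H a)).
Proof.
  unfold pi_minus, Rinf. do 2 f_equal. apply functional_extensionality; intros x.
  now rewrite Hminus_opp.
Qed.

Lemma le_pi_plus (H : nat -> R -> R) (p0 : nat -> R) (a : nat) (c p : R) :
  hyp_H (H a) (p0 a) -> Hplus H p0 a p <= c -> p <= pi_plus H p0 a c.
Proof.
  intros Hh Hp. apply (le_level_sup (H a)); [exact Hh|].
  eapply Rle_trans; [exact Hp|apply Rmax_l].
Qed.

Lemma pi_minus_le (H : nat -> R -> R) (p0 : nat -> R) (a : nat) (c p : R) :
  hyp_H (H a) (p0 a) -> Hminus H p0 a p <= c -> pi_minus H p0 a c <= p.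
Proof.
  intros Hh Hp. rewrite pi_minus_opp.
  rewrite <- (Ropp_involutive p), Hminus_opp in Hp.
  enough (- p <= Rsup (fun x => H a (- Rmax x (- p0 a)) = Rmax c (Amin H a))) by lra.
  apply (le_level_sup (fun x => H a (- x))); [now apply hyp_H_opp|].
  eapply Rle_trans; [exact Hp|apply Rmax_l].
Qed.

Lemma Hplus_slope (H : nat -> R -> R) (p0 : nat -> R) (a : nat) (Lam c c' : R) :
  hyp_H (H a) (p0 a) -> 0 < Lam -> c <= c' ->
  (forall p d, p0 a <= p <= pi_plus H p0 a c' -> derivable_pt_lim (H a) p d -> Rabs d <= Lam) ->
  forall p s, 0 <= s -> Hplus H p0 a p + Lam * s <= c ->
    Hplus H p0 a (p + s) <= Hplus H p0 a p + Lam * s.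
Proof.
  intros Hh HLam Hcc Hder. unfold Hplus.
  apply clip_slope with (Rmax c' (Amin H a)); try assumption.
  - eapply Rle_trans; [exact Hcc|apply Rmax_l].
  - intros p d Hp Hd. eapply Rle_trans; [apply Rle_abs|]. now apply Hder with p.
Qed.

Lemma Hminus_slope (H : nat -> R -> R) (p0 : nat -> R) (a : nat) (Lam c c' : R) :
  hyp_H (H a) (p0 a) -> 0 < Lam -> c <= c' ->
  (forall p d, pi_minus H p0 a c' <= p <= p0 a -> derivable_pt_lim (H a) p d -> Rabs d <= Lam) ->
  forall p s, 0 <= s -> Hminus H p0 a p + Lam * s <= c ->
    Hminus H p0 a (p - s) <= Hminus H p0 a p + Lam * s.
Proof.
  intros Hh HLam Hcc Hder p s Hs Hps.
  rewrite <- (Ropp_involutive p) in Hps |- *.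
  replace (- - p - s) with (- (- p + s)) by ring.
  rewrite !Hminus_opp in *.
  apply (clip_slope (fun x => H a (- x)) (- p0 a) Lam c (Rmax c' (Amin H a)));
    try assumption.
  - now apply hyp_H_opp.
  - eapply Rle_trans; [exact Hcc|apply Rmax_l].
  - intros z d Hz Hd. eapply Rle_trans; [apply Rle_abs|]. rewrite <- Rabs_Ropp.
    apply Hder with (- z).
    + rewrite pi_minus_opp. lra.
    + replace (H a) with (fun x => (fun y => H a (- y)) (- x)).
      * replace (- d) with (d * - 1) by ring.
        apply (derivable_pt_lim_comp Ropp (fun y => H a (- y))).
        -- apply (derivable_pt_lim_opp id). apply derivable_pt_lim_id.
        -- now rewrite Ropp_involutive.
      * apply functional_extensionality; intros x. now rewrite Ropp_involutive.
Qed.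

(** * Piecewise C1 functions along the diagonal *)

Definition nearN (N : nat) (r : R) (p q : nat -> R) : Prop :=
  forall b, (b < N)%nat -> Rabs (q b - p b) < r.

(** Translation along the diagonal (1, ..., 1), the direction in which the derivative is the sum of
    the partial derivatives. *)
Definition shift (p : nat -> R) (t : R) : nat -> R := fun b => p b + t.

Lemma sumN_ext (N : nat) (f g : nat -> R) :
  (forall b, (b < N)%nat -> f b = g b) -> sumN N f = sumN N g.
Proof.
  induction N as [|N IH]; intros Hfg; simpl; [reflexivity|].
  rewrite IH, Hfg; auto with arith.
Qed.

Lemma sumN_le (N : nat) (f g : nat -> R) :
  (forall b, (b < N)%nat -> f b <= g b) -> sumN N f <= sumN N g.
Proof.
  induction N as [|N IH]; intros Hfg; simpl; [lra|].
  apply Rplus_le_compat; auto with arith.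
Qed.

Lemma sumN_mult_r (N : nat) (f : nat -> R) (c : R) :
  sumN N (fun b => f b * c) = sumN N f * c.
Proof. induction N as [|N IH]; simpl; [ring|rewrite IH; ring]. Qed.

Lemma sumN_const (N : nat) (c : R) : sumN N (fun _ => c) = INR N * c.
Proof. induction N as [|N IH]; [simpl; ring|rewrite S_INR; simpl; rewrite IH; ring]. Qed.

(** The minimum of the finitely many radii works, because the property passes to smaller radii. *)
Lemma finite_radius (n : nat) (P : nat -> R -> Prop) :
  (forall k d d', 0 < d' <= d -> P k d -> P k d') ->
  (forall k, (k < n)%nat -> exists d, 0 < d /\ P k d) ->
  exists d, 0 < d /\ forall k, (k < n)%nat -> P k d.
Proof.
  intros Hanti. induction n as [|n IH]; intros HP.
  - exists 1. split; [lra|]. intros k Hk; lia.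
  - destruct IH as [d [Hd HPd]]; [auto with arith|].
    destruct (HP n) as [d' [Hd' HPd']]; [auto with arith|].
    assert (0 < Rmin d d') by now apply Rmin_pos.
    exists (Rmin d d'). split; [assumption|]. intros k Hk.
    destruct (Nat.eq_dec k n) as [->|Hne].
    + apply Hanti with d'; [split; [assumption|apply Rmin_r]|exact HPd'].
    + apply Hanti with d; [split; [assumption|apply Rmin_l]|apply HPd; lia].
Qed.

Lemma nearN_le (N : nat) (r r' : R) (p q : nat -> R) :
  r' <= r -> nearN N r' p q -> nearN N r p q.
Proof. intros Hr Hq b Hb. specialize (Hq b Hb). lra. Qed.

Lemma nearN_trans (N : nat) (r r' : R) (p q s : nat -> R) :
  nearN N r p q -> nearN N r' q s -> nearN N (r + r') p s.
Proof.
  intros Hq Hs b Hb. specialize (Hq b Hb). specialize (Hs b Hb).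
  replace (s b - p b) with (s b - q b + (q b - p b)) by ring.
  pose proof (Rabs_triang (s b - q b) (q b - p b)). lra.
Qed.

Lemma nearN_refl (N : nat) (r : R) (p : nat -> R) : 0 < r -> nearN N r p p.
Proof. intros Hr b _. rewrite Rminus_diag, Rabs_R0. exact Hr. Qed.

Lemma nearN_shift (N : nat) (r : R) (p : nat -> R) (t : R) :
  Rabs t < r -> nearN N r p (shift p t).
Proof. intros Ht b _. unfold shift. now replace (p b + t - p b) with t by ring. Qed.

Lemma nearN_upd (N : nat) (r : R) (p q : nat -> R) (b : nat) (t : R) :
  nearN N r p q -> Rabs (t - p b) < r -> nearN N r p (upd q b t).
Proof.
  intros Hq Ht d Hd. unfold upd. destruct (Nat.eq_dec d b) as [->|]; [exact Ht|now apply Hq].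
Qed.

Lemma upd_same (p : nat -> R) (b : nat) (t : R) : upd p b t b = t.
Proof. unfold upd. now destruct (Nat.eq_dec b b). Qed.

Lemma upd_upd (p : nat -> R) (b : nat) (s t : R) : upd (upd p b s) b t = upd p b t.
Proof.
  apply functional_extensionality; intros d. unfold upd. now destruct (Nat.eq_dec d b).
Qed.

(** * Continuous functions of [N] variables and finite closed covers *)

Lemma continuous_N_minus (N : nat) (f g : (nat -> R) -> R) :
  continuous_N N f -> continuous_N N g -> continuous_N N (fun p => f p - g p).
Proof.
  intros Hf Hg p eps Heps.
  destruct (Hf p (eps / 2)) as [d [Hd Hfd]]; [lra|].
  destruct (Hg p (eps / 2)) as [d' [Hd' Hgd]]; [lra|].
  exists (Rmin d d'). split; [now apply Rmin_pos|]. intros q Hq.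
  assert (Rabs (f q - f p) < eps / 2)
    by (apply Hfd; apply (nearN_le N d _ p q (Rmin_l d d') Hq)).
  assert (Rabs (g q - g p) < eps / 2)
    by (apply Hgd; apply (nearN_le N d' _ p q (Rmin_r d d') Hq)).
  replace (f q - g q - (f p - g p)) with (f q - f p - (g q - g p)) by ring.
  eapply Rle_lt_trans; [apply Rabs_triang|]. rewrite Rabs_Ropp. lra.
Qed.

Lemma continuous_N_const (N : nat) (c : R) : continuous_N N (fun _ => c).
Proof.
  intros p eps Heps. exists 1. split; [lra|]. intros q _. rewrite Rminus_diag, Rabs_R0. exact Heps.
Qed.

Lemma continuous_N_opp_sum (N n : nat) (f : nat -> (nat -> R) -> R) :
  (forall b, (b < n)%nat -> continuous_N N (f b)) ->
  continuous_N N (fun p => - sumN n (fun b => f b p)).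
Proof.
  induction n as [|n IH]; intros Hf; simpl.
  - apply continuous_N_const.
  - replace (fun p => - (sumN n (fun b => f b p) + f n p))
      with (fun p => - sumN n (fun b => f b p) - f n p)
      by (apply functional_extensionality; intros p; ring).
    apply (continuous_N_minus N (fun p => - sumN n (fun b => f b p))); auto with arith.
Qed.

Lemma continuous_N_pos (N : nat) (f : (nat -> R) -> R) (p : nat -> R) :
  continuous_N N f -> 0 < f p ->
  exists r, 0 < r /\ forall q, nearN N r p q -> 0 < f q.
Proof.
  intros Hf Hp. destruct (Hf p (f p) Hp) as [r [Hr Hq]].
  exists r. split; [exact Hr|]. intros q Hnear.
  apply Hq, Rabs_def2 in Hnear. lra.
Qed.

Lemma continuous_N_diagonal (N : nat) (f : (nat -> R) -> R) (p : nat -> R) :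
  continuous_N N f -> continuity (fun s => f (shift p (- s))).
Proof.
  intros Hf s eps Heps. destruct (Hf (shift p (- s)) eps Heps) as [d [Hd Hq]].
  exists d. split; [exact Hd|]. intros t [_ Ht]. simpl in *. unfold Rdist in *.
  apply Hq. intros b _. unfold shift.
  replace (p b + - t - (p b + - s)) with (- (t - s)) by ring. now rewrite Rabs_Ropp.
Qed.

(** Finite form of Baire's theorem, by induction on the number of sets: either the last set fills
    the ball of half the radius, or some smaller ball avoids it by closedness and is covered by the
    remaining sets. *)
Lemma finite_closed_cover_interior (N K : nat) (E : nat -> (nat -> R) -> Prop) :
  (forall k p, (k < K)%nat -> ~ E k p ->
     exists r, 0 < r /\ forall q, nearN N r p q -> ~ E k q) ->
  forall p r, 0 < r -> (forall q, nearN N r p q -> exists k, (k < K)%nat /\ E k q) ->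
  exists q s k, (k < K)%nat /\ 0 < s /\ nearN N r p q /\ forall z, nearN N s q z -> E k z.
Proof.
  induction K as [|K IH]; intros Hclosed p r Hr Hcover.
  - destruct (Hcover p) as [k [Hk _]]; [now apply nearN_refl|lia].
  - destruct (classic (forall q, nearN N (r / 2) p q -> E K q)) as [Hall|Hex].
    + exists p, (r / 2), K. repeat split; [lia|lra|now apply nearN_refl|exact Hall].
    + apply not_all_ex_not in Hex. destruct Hex as [q Hq].
      apply imply_to_and in Hq. destruct Hq as [Hpq Hq].
      destruct (Hclosed K q) as [s [Hs HEs]]; [lia|exact Hq|].
      assert (Hm : 0 < Rmin s (r / 2)) by (apply Rmin_pos; lra).
      assert (Hsub : forall z, nearN N (Rmin s (r / 2)) q z -> nearN N r p z).
      { intros z Hz. apply nearN_le with (r / 2 + r / 2); [lra|].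
        apply nearN_trans with q; [exact Hpq|].
        now apply nearN_le with (Rmin s (r / 2)); [apply Rmin_r|]. }
      destruct (IH ltac:(intros k z Hk; apply Hclosed; lia) q (Rmin s (r / 2)) Hm)
        as (z & d & k & Hk & Hd & Hz & HE).
      * intros z Hz. destruct (Hcover z) as [k [Hk HEk]]; [now apply Hsub|].
        destruct (Nat.eq_dec k K) as [->|Hne]; [|exists k; split; [lia|exact HEk]].
        exfalso. apply (HEs z); [|exact HEk].
        now apply nearN_le with (Rmin s (r / 2)); [apply Rmin_l|].
      * exists z, d, k. repeat split; [lia|exact Hd|now apply Hsub|exact HE].
Qed.

(** * Gradients and first-order expansion of C1 functions *)

Definition is_gradient (N : nat) (G : (nat -> R) -> R) (dG : nat -> (nat -> R) -> R) : Prop :=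
  forall b, (b < N)%nat ->
    (forall p, derivable_pt_lim (fun t => G (upd p b t)) (p b) (dG b p)) /\
    continuous_N N (dG b).

Lemma C1N_gradient (N : nat) (G : (nat -> R) -> R) :
  C1N N G -> exists dG, is_gradient N G dG.
Proof.
  intros HG.
  exists (fun b => ClassicalEpsilon.epsilon (inhabits (fun _ => 0)) (fun dG : (nat -> R) -> R =>
    (forall p, derivable_pt_lim (fun t => G (upd p b t)) (p b) (dG p)) /\ continuous_N N dG)).
  intros b Hb. apply ClassicalEpsilon.epsilon_spec. now apply HG.
Qed.

Lemma mean_value (f f' : R -> R) (u v : R) :
  (forall x, derivable_pt_lim f x (f' x)) ->
  exists c, f v - f u = f' c * (v - u) /\ Rabs (c - u) <= Rabs (v - u).
Proof.
  intros Hf. destruct (Rtotal_order u v) as [Huv|[->|Hvu]].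
  - destruct (MVT_cor2 f f' u v Huv) as [c [Hc Hucv]]; [auto|].
    exists c. split; [exact Hc|]. rewrite !Rabs_pos_eq; lra.
  - exists v. split; [ring|apply Rle_refl].
  - destruct (MVT_cor2 f f' v u Hvu) as [c [Hc Hucv]]; [auto|].
    exists c. split; [lra|]. rewrite !Rabs_left1; lra.
Qed.

(** The coordinates are changed from [p] to [q] one at a time, [h n] being the point after [n]
    changes. Each change is evaluated by the mean value theorem, and continuity compares the partial
    derivative at the intermediate point with the one at [p]. *)
Lemma gradient_expansion (N : nat) (G : (nat -> R) -> R) (dG : nat -> (nat -> R) -> R)
    (p : nat -> R) (eps : R) :
  depends_only N G -> is_gradient N G dG -> 0 < eps ->
  exists d, 0 < d /\ forall q, nearN N d p q ->
    Rabs (G q - G p - sumN N (fun b => dG b p * (q b - p b)))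
      <= eps * sumN N (fun b => Rabs (q b - p b)).
Proof.
  intros Hdep Hgrad Heps.
  destruct (finite_radius N (fun b d => forall q, nearN N d p q -> Rabs (dG b q - dG b p) < eps))
    as [d [Hd Hcont]].
  { intros b d d' Hd Hb q Hq. apply Hb. now apply nearN_le with d'. }
  { intros b Hb. destruct (Hgrad b Hb) as [_ Hc]. now apply Hc. }
  exists d. split; [exact Hd|]. intros q Hq.
  set (h := fun n b => if lt_dec b n then q b else p b).
  assert (Hh : forall n, nearN N d p (h n)).
  { intros n b Hb. unfold h. destruct (lt_dec b n); [now apply Hq|].
    now apply (nearN_refl N d p). }
  enough (forall n, (n <= N)%nat ->
            Rabs (G (h n) - G p - sumN n (fun b => dG b p * (q b - p b)))
              <= eps * sumN n (fun b => Rabs (q b - p b))) as Hind.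
  { specialize (Hind N (Nat.le_refl N)). rewrite (Hdep q (h N)); [exact Hind|].
    intros b Hb. unfold h. now destruct (lt_dec b N). }
  induction n as [|n IH]; intros Hn; simpl.
  - rewrite (Hdep (h 0%nat) p) by (intros b _; unfold h; now destruct (lt_dec b 0)).
    rewrite Rmult_0_r, !Rminus_diag, Rabs_R0. lra.
  - assert (HnN : (n < N)%nat) by lia. specialize (IH ltac:(lia)).
    destruct (mean_value (fun t => G (upd (h n) n t)) (fun t => dG n (upd (h n) n t)) (p n) (q n))
      as [c [Hc Hcp]].
    { intros x. destruct (Hgrad n HnN) as [Hder _]. specialize (Hder (upd (h n) n x)).
      rewrite upd_same in Hder.
      replace (fun t => G (upd (h n) n t)) with (fun t => G (upd (upd (h n) n x) n t));
        [exact Hder|].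
      apply functional_extensionality; intros t. now rewrite upd_upd. }
    replace (G (upd (h n) n (q n))) with (G (h (S n))) in Hc.
    2:{ apply Hdep. intros b _. unfold h, upd.
        destruct (Nat.eq_dec b n) as [->|]; destruct (lt_dec _ (S n)); try lia;
          try destruct (lt_dec b n); try lia; reflexivity. }
    replace (G (upd (h n) n (p n))) with (G (h n)) in Hc.
    2:{ apply Hdep. intros b _. unfold h, upd.
        destruct (Nat.eq_dec b n) as [->|]; [|reflexivity].
        destruct (lt_dec n n); [lia|reflexivity]. }
    assert (Hdc : Rabs (dG n (upd (h n) n c) - dG n p) < eps).
    { apply Hcont; [exact HnN|]. apply nearN_upd; [apply Hh|].
      specialize (Hq n HnN). lra. }
    replace (G (h (S n)) - G p - (sumN n (fun b => dG b p * (q b - p b)) + dG n p * (q n - p n)))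
      with (G (h n) - G p - sumN n (fun b => dG b p * (q b - p b))
            + (dG n (upd (h n) n c) - dG n p) * (q n - p n)) by lra.
    eapply Rle_trans; [apply Rabs_triang|].
    rewrite Rmult_plus_distr_l. apply Rplus_le_compat; [exact IH|].
    rewrite Rabs_mult. apply Rmult_le_compat_r; [apply Rabs_pos|lra].
Qed.

Lemma Rabs_sumN_le (N : nat) (f : nat -> R) : Rabs (sumN N f) <= sumN N (fun b => Rabs (f b)).
Proof.
  induction N as [|N IH]; simpl; [rewrite Rabs_R0; lra|].
  eapply Rle_trans; [apply Rabs_triang|lra].
Qed.

Lemma C1N_continuous (N : nat) (G : (nat -> R) -> R) :
  depends_only N G -> C1N N G -> continuous_N N G.
Proof.
  intros Hdep HG p eps Heps.
  destruct (C1N_gradient N G HG) as [dG HdG].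
  destruct (gradient_expansion N G dG p 1 Hdep HdG) as [d [Hd Hexp]]; [lra|].
  (* [C] collects the linear part and the error of the expansion with constant 1, so that [G] varies
     by at most [C * r] on the cube of radius [r]. *)
  set (C := sumN N (fun b => Rabs (dG b p) + 1)).
  assert (HC : 0 <= C).
  { replace 0 with (sumN N (fun _ => 0)) by (rewrite sumN_const; ring).
    apply sumN_le. intros b _. pose proof (Rabs_pos (dG b p)). lra. }
  set (r := Rmin d (eps / (C + 1))).
  assert (Hr : 0 < r) by (apply Rmin_pos; [exact Hd|apply Rdiv_lt_0_compat; lra]).
  exists r. split; [exact Hr|]. intros q Hq.
  assert (Hqd : nearN N d p q) by (apply nearN_le with r; [apply Rmin_l|exact Hq]).
  apply Hexp in Hqd.
  assert (Hsum : sumN N (fun b => Rabs (dG b p * (q b - p b))) + sumN N (fun b => Rabs (q b - p b))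
                 <= C * r).
  { unfold C. rewrite <- sumN_mult_r.
    enough (forall n, (n <= N)%nat -> sumN n (fun b => Rabs (dG b p * (q b - p b)))
              + sumN n (fun b => Rabs (q b - p b)) <= sumN n (fun b => (Rabs (dG b p) + 1) * r))
      by auto.
    induction n as [|n IH]; intros Hn; simpl; [lra|].
    specialize (IH ltac:(lia)). specialize (Hq n ltac:(lia)).
    rewrite Rabs_mult. pose proof (Rabs_pos (dG n p)). nra. }
  assert (Hfin : C * r < eps).
  { apply Rle_lt_trans with (C * (eps / (C + 1))).
    - apply Rmult_le_compat_l; [exact HC|apply Rmin_r].
    - replace eps with ((C + 1) * (eps / (C + 1))) at 2 by (field; lra).
      apply Rmult_lt_compat_r; [apply Rdiv_lt_0_compat|]; lra. }
  pose proof (Rabs_sumN_le N (fun b => dG b p * (q b - p b))).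
  replace (G q - G p) with (G q - G p - sumN N (fun b => dG b p * (q b - p b))
    + sumN N (fun b => dG b p * (q b - p b))) by ring.
  eapply Rle_lt_trans; [apply Rabs_triang|]. lra.
Qed.

(** * Slope of [F] along the diagonal of a box *)

Section DiagonalSlope.
Context (N : nat) (F : (nat -> R) -> R) (l u : nat -> R) (Lam : R).
Context (HLam0 : 0 < Lam) (HF : piecewise_C1 N F) (Hlu : forall b, (b < N)%nat -> l b < u b)
  (HLam : forall p dF : nat -> R,
     (forall b, (b < N)%nat -> l b <= p b <= u b) ->
     (forall b, (b < N)%nat -> derivable_pt_lim (fun t => F (upd p b t)) (p b) (dF b)) ->
     - sumN N dF <= Lam).

Definition in_open_box (p : nat -> R) : Prop := forall b, (b < N)%nat -> l b < p b < u b.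

Lemma open_box_nearN (p : nat -> R) :
  in_open_box p -> exists r, 0 < r /\ forall q, nearN N r p q -> in_open_box q.
Proof.
  intros Hp.
  destruct (finite_radius N (fun b r => forall x, Rabs (x - p b) < r -> l b < x < u b))
    as [r [Hr Hbox]].
  - intros b d d' Hd Hb x Hx. apply Hb. lra.
  - intros b Hb. specialize (Hp b Hb). exists (Rmin (p b - l b) (u b - p b)).
    split; [apply Rmin_pos; lra|]. intros x Hx. apply Rabs_def2 in Hx.
    pose proof (Rmin_l (p b - l b) (u b - p b)). pose proof (Rmin_r (p b - l b) (u b - p b)). lra.
  - exists r. split; [exact Hr|]. intros q Hq b Hb. apply (Hbox b Hb). now apply Hq.
Qed.

(* In the open box the piece [G] is active at [p] with the slope bound inherited from [F].
   Unlike differentiability of [F], this is a closed condition on [p]. *)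
Definition slope_piece (G : (nat -> R) -> R) (dG : nat -> (nat -> R) -> R) (p : nat -> R) : Prop :=
  F p = G p /\ - sumN N (fun b => dG b p) <= Lam.

(** Failure means that one of three strict inequalities between continuous functions holds at [p],
    and such an inequality persists nearby. *)
Lemma slope_piece_closed (G : (nat -> R) -> R) (dG : nat -> (nat -> R) -> R) (p : nat -> R) :
  continuous_N N G -> is_gradient N G dG -> ~ slope_piece G dG p ->
  exists r, 0 < r /\ forall q, nearN N r p q -> ~ slope_piece G dG q.
Proof.
  intros HG HdG Hp. destruct HF as [HFc _].
  assert (Hcase : 0 < F p - G p \/ 0 < G p - F p \/ 0 < - sumN N (fun b => dG b p) - Lam).
  { apply not_and_or in Hp. destruct Hp as [Hp|Hp]; [|lra].
    apply Rdichotomy in Hp. lra. }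
  destruct Hcase as [Hpos|[Hpos|Hpos]].
  - destruct (continuous_N_pos N (fun q => F q - G q) p) as [r [Hr Hq]];
      [now apply continuous_N_minus|exact Hpos|].
    exists r. split; [exact Hr|]. intros q Hnear [HFG _]. apply Hq in Hnear. lra.
  - destruct (continuous_N_pos N (fun q => G q - F q) p) as [r [Hr Hq]];
      [now apply continuous_N_minus|exact Hpos|].
    exists r. split; [exact Hr|]. intros q Hnear [HFG _]. apply Hq in Hnear. lra.
  - destruct (continuous_N_pos N (fun q => - sumN N (fun b => dG b q) - Lam) p) as [r [Hr Hq]].
    + apply (continuous_N_minus N (fun q => - sumN N (fun b => dG b q)));
        [|apply continuous_N_const].
      apply continuous_N_opp_sum. intros b Hb. now apply HdG.
    + exact Hpos.
    + exists r. split; [exact Hr|]. intros q Hnear [_ Hsl]. apply Hq in Hnear. lra.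
Qed.

(** Where [F] coincides with [G] on a neighbourhood it inherits the partial derivatives of [G], so
    the bound assumed for [F] becomes a bound for [dG]. *)
Lemma interior_slope_piece (G : (nat -> R) -> R) (dG : nat -> (nat -> R) -> R)
    (p : nat -> R) (r : R) :
  is_gradient N G dG -> in_open_box p -> 0 < r ->
  (forall q, nearN N r p q -> F q = G q) -> slope_piece G dG p.
Proof.
  intros HdG Hp Hr HFG. split; [now apply HFG, nearN_refl|].
  apply HLam with p.
  - intros b Hb. specialize (Hp b Hb). lra.
  - intros b Hb. apply derivable_pt_lim_local with (fun t => G (upd p b t)) r; [exact Hr| |].
    + intros t Ht. symmetry. apply HFG, nearN_upd; [now apply nearN_refl|exact Ht].
    + now apply HdG.
Qed.

Lemma diagonal_slope_local (p : nat -> R) (eps : R) :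
  in_open_box p -> 0 < eps ->
  exists d, 0 < d /\ forall t, 0 <= t < d -> F (shift p (- t)) <= F p + (Lam + eps) * t.
Proof.
  intros Hp Heps. destruct HF as [HFc (K & Fk & HFk & Hsel)].
  set (dF := fun k => ClassicalEpsilon.epsilon (inhabits (fun _ _ => 0)) (is_gradient N (Fk k))).
  assert (HdF : forall k, (k < K)%nat -> is_gradient N (Fk k) (dF k)).
  { intros k Hk. apply ClassicalEpsilon.epsilon_spec. apply C1N_gradient, HFk, Hk. }
  assert (Hcont : forall k, (k < K)%nat -> continuous_N N (Fk k)).
  { intros k Hk. apply C1N_continuous; now apply HFk. }
  (* If no piece qualified at [q], none would on a whole ball around [q]. By the covering lemma that
     ball contains a smaller one on which [F] equals a single piece, and this piece does qualify at
     its centre. *)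
  assert (Hpiece : forall q, in_open_box q ->
            exists k, (k < K)%nat /\ slope_piece (Fk k) (dF k) q).
  { intros q Hq. apply NNPP. intros Hno.
    destruct (finite_radius K
        (fun k r => forall z, nearN N r q z -> ~ slope_piece (Fk k) (dF k) z)) as [r [Hr Hbad]].
    { intros k d d' Hd Hk z Hz. apply Hk. now apply nearN_le with d'. }
    { intros k Hk. apply slope_piece_closed; [now apply Hcont|now apply HdF|].
      intros Hsp. apply Hno. now exists k. }
    destruct (open_box_nearN q Hq) as [r' [Hr' Hbox]].
    assert (Hm : 0 < Rmin r r') by now apply Rmin_pos.
    destruct (finite_closed_cover_interior N K (fun k z => F z = Fk k z)) with q (Rmin r r')
      as (z & s & k & Hk & Hs & Hz & HE).
    - intros k z Hk Hne.
      assert (Hcase : 0 < F z - Fk k z \/ 0 < Fk k z - F z) by (apply Rdichotomy in Hne; lra).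
      destruct Hcase as [Hpos|Hpos].
      + destruct (continuous_N_pos N (fun x => F x - Fk k x) z) as [s [Hs Hx]];
          [apply continuous_N_minus; auto|exact Hpos|].
        exists s. split; [exact Hs|]. intros x Hnear. apply Hx in Hnear. lra.
      + destruct (continuous_N_pos N (fun x => Fk k x - F x) z) as [s [Hs Hx]];
          [apply continuous_N_minus; auto|exact Hpos|].
        exists s. split; [exact Hs|]. intros x Hnear. apply Hx in Hnear. lra.
    - exact Hm.
    - intros z _. apply Hsel.
    - apply (Hbad k Hk z); [apply nearN_le with (Rmin r r'); [apply Rmin_l|exact Hz]|].
      apply interior_slope_piece with s; auto.
      apply Hbox, nearN_le with (Rmin r r'); [apply Rmin_r|exact Hz]. }
  (* A piece that qualifies at [p] equals [F] at both endpoints, so its expansion at [p] controls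
     the increment. A piece that does not qualify at [p] qualifies nowhere near [p]. *)
  destruct (finite_radius K (fun k d => forall t, 0 <= t < d ->
      slope_piece (Fk k) (dF k) (shift p (- t)) ->
      F (shift p (- t)) <= F p + (Lam + eps) * t)) as [d [Hd Hslope]].
  { intros k d d' Hd Hk t Ht. apply Hk. lra. }
  { intros k Hk. destruct (classic (slope_piece (Fk k) (dF k) p)) as [[HFp HLp]|Hbad].
    - assert (HN : 0 <= INR N) by apply pos_INR.
      (* The coordinate increments add up to [INR N * t], so this precision leaves an error of at
         most [eps * t]. *)
      destruct (gradient_expansion N (Fk k) (dF k) p (eps / (INR N + 1)))
        as [d [Hd Hexp]]; [now apply HFk|now apply HdF|apply Rdiv_lt_0_compat; lra|].
      exists d. split; [exact Hd|]. intros t Ht [HFt _].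
      specialize (Hexp (shift p (- t))).
      rewrite (sumN_ext N _ (fun b => dF k b p * - t)) in Hexp
        by (intros b _; unfold shift; ring).
      rewrite (sumN_ext N (fun b => Rabs _) (fun _ => t)) in Hexp.
      2:{ intros b _. unfold shift. replace (p b + - t - p b) with (- t) by ring.
          rewrite Rabs_Ropp. apply Rabs_pos_eq. lra. }
      rewrite sumN_mult_r, sumN_const in Hexp.
      rewrite HFp, HFt.
      assert (Hsmall : eps / (INR N + 1) * (INR N * t) <= eps * t).
      { replace (eps / (INR N + 1) * (INR N * t)) with (eps * t * (INR N / (INR N + 1)))
          by (field; lra).
        rewrite <- (Rmult_1_r (eps * t)) at 2. apply Rmult_le_compat_l; [nra|].
        apply Rmult_le_reg_r with (INR N + 1); [lra|].
        unfold Rdiv. rewrite Rmult_assoc, Rinv_l by lra. lra. }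
      assert (Hnear : nearN N d p (shift p (- t))).
      { apply nearN_shift. rewrite Rabs_Ropp, Rabs_pos_eq; lra. }
      apply Hexp in Hnear.
      pose proof (Rle_abs (Fk k (shift p (- t)) - Fk k p - sumN N (fun b => dF k b p) * - t)).
      nra.
    - destruct (slope_piece_closed (Fk k) (dF k) p) as [d [Hd Hno]]; auto.
      exists d. split; [exact Hd|]. intros t Ht Hsp. exfalso.
      apply (Hno (shift p (- t))); [|exact Hsp].
      apply nearN_shift. rewrite Rabs_Ropp, Rabs_pos_eq; lra. }
  destruct (open_box_nearN p Hp) as [r [Hr Hbox]].
  exists (Rmin d r). split; [now apply Rmin_pos|]. intros t Ht.
  pose proof (Rmin_l d r). pose proof (Rmin_r d r).
  destruct (Hpiece (shift p (- t))) as [k [Hk Hsp]].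
  - apply Hbox, nearN_shift. rewrite Rabs_Ropp, Rabs_pos_eq; lra.
  - apply (Hslope k Hk); [lra|exact Hsp].
Qed.

(** All points between the two ends lie in the open box, so the local estimate applies at each of
    them. The excess slope [e / (S + 1)] adds at most [e] over the length [S]. *)
Lemma diagonal_slope_open_box (p : nat -> R) (S : R) :
  0 <= S -> in_open_box p -> in_open_box (shift p (- S)) ->
  F (shift p (- S)) <= F p + Lam * S.
Proof.
  intros HS Hp HpS. destruct HF as [HFc _].
  apply le_epsilon. intros e He.
  assert (Hshift0 : shift p (- 0) = p)
    by (apply functional_extensionality; intros b; unfold shift; ring).
  assert (HeS : 0 < e / (S + 1)) by (apply Rdiv_lt_0_compat; lra).
  pose proof (le_of_right_slope_le (fun s => F (shift p (- s))) (Lam + e / (S + 1)) S HS) as Hle.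
  cbv beta in Hle. rewrite Hshift0 in Hle.
  enough (F (shift p (- S)) <= F p + (Lam + e / (S + 1)) * S).
  { assert (e / (S + 1) * S <= e); [|lra].
    replace e with (e / (S + 1) * (S + 1)) at 2 by (field; lra).
    apply Rmult_le_compat_l; lra. }
  apply Hle.
  - now apply continuous_N_diagonal with N.
  - intros s Hs. destruct (diagonal_slope_local (shift p (- s)) (e / (S + 1))) as [d [Hd Hslope]].
    + intros b Hb. specialize (Hp b Hb). specialize (HpS b Hb). unfold shift in *. lra.
    + exact HeS.
    + exists d. split; [exact Hd|]. intros t Ht.
      replace (shift p (- t)) with (shift (shift p (- s)) (- (t - s)))
        by (apply functional_extensionality; intros b; unfold shift; ring).
      apply Hslope. lra.
Qed.

Lemma diagonal_slope_box (p : nat -> R) (S : R) :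
  0 <= S -> (forall b, (b < N)%nat -> p b <= u b) ->
  (forall b, (b < N)%nat -> l b <= shift p (- S) b) ->
  F (shift p (- S)) <= F p + Lam * S.
Proof.
  intros HS Hpu HpS. destruct HF as [HFc _].
  apply le_epsilon. intros e He.
  set (c := fun b => (l b + u b) / 2).
  (* Contracting the segment towards the centre of the box makes it interior. *)
  set (pt := fun t b => p b + t * (c b - p b)).
  destruct (HFc p (e / 3)) as [d1 [Hd1 HF1]]; [lra|].
  destruct (HFc (shift p (- S)) (e / 3)) as [d2 [Hd2 HF2]]; [lra|].
  set (d := Rmin d1 d2).
  assert (Hd : 0 < d) by now apply Rmin_pos.
  destruct (finite_radius N (fun b t => forall s, 0 < s < t ->
      Rabs (s * (c b - p b)) < d /\ Rabs (s * (c b - p b + S)) < d)) as [t [Ht Hclose]].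
  { intros b t t' Ht Hb s Hs. apply Hb. lra. }
  { intros b Hb. set (m := Rabs (c b - p b) + Rabs (c b - p b + S) + 1).
    pose proof (Rabs_pos (c b - p b)). pose proof (Rabs_pos (c b - p b + S)).
    exists (d / m). assert (Hm : 0 < m) by (unfold m; lra).
    split; [now apply Rdiv_lt_0_compat|]. intros s Hs.
    assert (Hsm : s * m < d).
    { replace d with (d / m * m) by (field; lra). apply Rmult_lt_compat_r; lra. }
    rewrite !Rabs_mult, (Rabs_pos_eq s) by lra. unfold m in Hsm. split; nra. }
  set (s := Rmin (t / 2) (1 / 2)).
  assert (Hs : 0 < s < t /\ s <= 1 / 2).
  { unfold s. pose proof (Rmin_l (t / 2) (1 / 2)). pose proof (Rmin_r (t / 2) (1 / 2)).
    assert (0 < Rmin (t / 2) (1 / 2)) by (apply Rmin_pos; lra). lra. }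
  assert (Hbase : nearN N d1 p (pt s)).
  { intros b Hb. unfold pt. replace (p b + s * (c b - p b) - p b) with (s * (c b - p b)) by ring.
    destruct (Hclose b Hb s) as [Hb1 _]; [lra|].
    pose proof (Rmin_l d1 d2). unfold d in Hb1. lra. }
  assert (Hend : nearN N d2 (shift p (- S)) (shift (pt s) (- ((1 - s) * S)))).
  { intros b Hb. unfold pt, shift.
    replace (p b + s * (c b - p b) + - ((1 - s) * S) - (p b + - S))
      with (s * (c b - p b + S)) by ring.
    destruct (Hclose b Hb s) as [_ Hb2]; [lra|].
    pose proof (Rmin_r d1 d2). unfold d in Hb2. lra. }
  apply HF1, Rabs_def2 in Hbase. apply HF2, Rabs_def2 in Hend.
  (* The contraction has ratio [1 - s], hence the length [(1 - s) * S] of the interior segment. *)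
  assert (Hin : F (shift (pt s) (- ((1 - s) * S))) <= F (pt s) + Lam * ((1 - s) * S)).
  { apply diagonal_slope_open_box.
    - apply Rmult_le_pos; lra.
    - intros b Hb. specialize (Hpu b Hb). specialize (HpS b Hb). specialize (Hlu b Hb).
      unfold pt, c, shift in *. nra.
    - intros b Hb. specialize (Hpu b Hb). specialize (HpS b Hb). specialize (Hlu b Hb).
      unfold pt, c, shift in *. nra. }
  assert (Lam * ((1 - s) * S) <= Lam * S).
  { apply Rmult_le_compat_l; [lra|]. nra. }
  lra.
Qed.

(** The crossing argument of [clip_slope] along the diagonal. Moving downwards preserves the upper
    bounds [u], and the level [c] enforces the lower bounds [l]. *)
Lemma diagonal_slope (c : R) :
  (forall p, F p <= c -> forall b, (b < N)%nat -> l b <= p b) ->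
  forall p s, (forall b, (b < N)%nat -> p b <= u b) -> 0 <= s -> F p + Lam * s <= c ->
    F (shift p (- s)) <= F p + Lam * s.
Proof.
  intros Hl p s Hpu Hs Hps. destruct HF as [HFc _].
  assert (Hshift0 : shift p (- 0) = p)
    by (apply functional_extensionality; intros b; unfold shift; ring).
  destruct (Rle_lt_dec (F (shift p (- s))) c) as [Hc|Hc].
  - apply diagonal_slope_box; [exact Hs|exact Hpu|now apply Hl].
  - exfalso.
    destruct (continuous_attains (fun t => F (shift p (- t))) 0 s c) as [z [Hz Hzc]].
    + now apply continuous_N_diagonal with N.
    + exact Hs.
    + rewrite Hshift0. nra.
    + lra.
    + assert (Hzs : F (shift p (- z)) <= F p + Lam * z).
      { apply diagonal_slope_box; [lra|exact Hpu|apply Hl; lra]. }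
      assert (z <> s) by (intros ->; lra).
      assert (z < s) by lra. nra.
Qed.
End DiagonalSlope.

(** * The scheme *)

(** The coordinates are raised one at a time through the points [h n]. *)
Lemma nonincreasing_of_upd (N : nat) (F : (nat -> R) -> R) (p q : nat -> R) :
  depends_only N F ->
  (forall p b s t, (b < N)%nat -> s < t -> F (upd p b t) < F (upd p b s)) ->
  (forall b, (b < N)%nat -> p b <= q b) -> F q <= F p.
Proof.
  intros Hdep Hdec Hpq.
  set (h := fun n b => if lt_dec b n then q b else p b).
  enough (forall n, (n <= N)%nat -> F (h n) <= F p) as Hind.
  { rewrite (Hdep q (h N)); [now apply Hind|].
    intros b Hb. unfold h. now destruct (lt_dec b N). }
  induction n as [|n IH]; intros Hn.
  - rewrite (Hdep (h 0%nat) p); [lra|]. intros b _. unfold h. now destruct (lt_dec b 0).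
  - specialize (IH ltac:(lia)). specialize (Hpq n ltac:(lia)).
    replace (F (h (S n))) with (F (upd (h n) n (q n))).
    2:{ apply Hdep. intros b _. unfold h, upd.
        destruct (Nat.eq_dec b n) as [->|]; destruct (lt_dec _ (S n)); try lia;
          try destruct (lt_dec b n); try lia; reflexivity. }
    replace (F (h n)) with (F (upd (h n) n (p n))) in IH.
    2:{ apply Hdep. intros b _. unfold h, upd.
        destruct (Nat.eq_dec b n) as [->|]; [|reflexivity].
        destruct (lt_dec n n); [lia|reflexivity]. }
    destruct (Req_dec (p n) (q n)) as [Heq|Hne]; [now rewrite <- Heq|].
    pose proof (Hdec (h n) n (p n) (q n) ltac:(lia) ltac:(lra)). lra.
Qed.

Section Gradient.
Context (N : nat) (HN : (1 <= N)%nat) (H : nat -> R -> R) (p0 : nat -> R)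
  (hH : forall a, (a < N)%nat -> hyp_H (H a) (p0 a))
  (F : (nat -> R) -> R) (hF : hyp_F N F)
  (pK : R -> nat -> R) (hpK : hyp_pK N F pK)
  (u0 : nat -> R -> R) (hu0 : lipschitz_J N u0)
  (dt dx : R) (hdt : 0 < dt) (hdx : 0 < dx)
  (hm0 : exists lb, forall a i, (a < N)%nat -> lb <= Wd H p0 F u0 dt dx 0 a i)
  (hCFL : CFLr H p0 F u0 dt dx pK N).

Notation W := (Wd H p0 F u0 dt dx).
Notation P := (pplus H p0 F u0 dt dx).
Notation m := (mn H p0 F u0 dt dx N).
Notation M := (Mn H p0 F u0 dt dx N).
Notation plow := (p_low H p0 F u0 dt dx N).
Notation pup := (p_up H p0 F u0 dt dx N).
Notation plow0 := (p_low0 H p0 F u0 dt dx pK N).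
Notation Lam := (dx / dt).

(** * Slopes, discrete time derivatives and gradient bounds *)

Lemma Lam_pos : 0 < Lam.
Proof. now apply Rdiv_lt_0_compat. Qed.

(** At time 0 the values agree because the origins of two branches are at distance 0 in the junction
    and [u0] is Lipschitz; later the update at node 0 is the same for all branches. *)
Lemma U_junction (n a : nat) :
  (a < N)%nat -> U H p0 F u0 dt dx n a 0 = U H p0 F u0 dt dx n 0 0.
Proof.
  intros Ha. destruct n as [|n]; [|reflexivity].
  destruct hu0 as [L HL]. simpl. rewrite Rmult_0_l.
  specialize (HL a 0%nat 0 0 Ha ltac:(lia) (Rle_refl 0) (Rle_refl 0)).
  replace (distJ a 0 0 0) with 0 in HL.
  - rewrite Rmult_0_r in HL.
    pose proof (Rle_abs (u0 a 0 - u0 0%nat 0)).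
    pose proof (Rle_abs (- (u0 a 0 - u0 0%nat 0))) as Hneg.
    rewrite Rabs_Ropp in Hneg. lra.
  - unfold distJ. destruct (Nat.eq_dec a 0); [rewrite Rminus_diag, Rabs_R0|]; ring.
Qed.

(** Time and space differences commute; the factor [dt / dx] is [1 / Lam]. *)
Lemma P_succ (n a i : nat) : P (S n) a i = P n a i + (W n a (S i) - W n a i) / Lam.
Proof. unfold pplus, Wd. field. lra. Qed.

Lemma W_interior (n a i : nat) :
  W n a (S i) = - Rmax (Hplus H p0 a (P n a i)) (Hminus H p0 a (P n a (S i))).
Proof. unfold pplus, Wd. simpl. field. lra. Qed.

Lemma W_junction (n a : nat) : (a < N)%nat -> W n a 0 = - F (fun b => P n b 0).
Proof. intros Ha. unfold pplus, Wd. rewrite (U_junction n a Ha). simpl. field. lra. Qed.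

Lemma m0_le_W (a i : nat) : (a < N)%nat -> m 0%nat <= W 0 a i.
Proof.
  intros Ha. destruct hm0 as [lb Hlb]. apply Rinf_lb with lb; [|now exists a, i].
  intros y (b & j & Hb & ->). now apply Hlb.
Qed.

Lemma W_interior_le (n a i : nat) : (a < N)%nat -> W n a (S i) <= - H a (p0 a).
Proof.
  intros Ha. rewrite W_interior.
  pose proof (hyp_H_min (H a) (p0 a) (Rmax (P n a i) (p0 a)) (hH a Ha)) as Hmin.
  pose proof (Rmax_l (Hplus H p0 a (P n a i)) (Hminus H p0 a (P n a (S i)))) as Hmax.
  unfold Hplus in *. lra.
Qed.

(** Both cases in the definitions of the bounds are inverses at one level [c] above [- m 0], so they
    can be treated together. *)
Lemma bounds_level (a : nat) :
  exists c, - m 0%nat <= c /\ pup a = pi_plus H p0 a c /\ plow a = pi_minus H p0 a c.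
Proof.
  unfold p_up, p_low. destruct (Rlt_dec _ _).
  - exists (- m 0%nat). repeat split; lra.
  - exists (- m 0%nat + 1). repeat split; lra.
Qed.

Lemma Hplus_le (n a i : nat) :
  (a < N)%nat -> m 0%nat <= W n a (S i) -> Hplus H p0 a (P n a i) <= - m 0%nat.
Proof.
  intros Ha Hm. rewrite W_interior in Hm.
  pose proof (Rmax_l (Hplus H p0 a (P n a i)) (Hminus H p0 a (P n a (S i)))). lra.
Qed.

Lemma Hminus_le (n a i : nat) :
  (a < N)%nat -> m 0%nat <= W n a (S i) -> Hminus H p0 a (P n a (S i)) <= - m 0%nat.
Proof.
  intros Ha Hm. rewrite W_interior in Hm.
  pose proof (Rmax_r (Hplus H p0 a (P n a i)) (Hminus H p0 a (P n a (S i)))). lra.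
Qed.

(** The slope to the right of node [i] is the backward slope of node [i + 1], so the upper bound
    includes the junction slope [i = 0]. The lower bound uses the forward slope of an interior node
    and therefore starts at node 1. *)
Lemma P_le_pup (n a i : nat) : (a < N)%nat -> m 0%nat <= W n a (S i) -> P n a i <= pup a.
Proof.
  intros Ha Hm. destruct (bounds_level a) as (c & Hc & -> & _).
  apply le_pi_plus; [now apply hH|]. apply Hplus_le in Hm; [lra|exact Ha].
Qed.

Lemma plow_le_P (n a i : nat) :
  (a < N)%nat -> m 0%nat <= W n a (S i) -> plow a <= P n a (S i).
Proof.
  intros Ha Hm. destruct (bounds_level a) as (c & Hc & _ & ->).
  apply pi_minus_le; [now apply hH|]. apply Hminus_le in Hm; [lra|exact Ha].
Qed.

Lemma plow0_le (p : nat -> R) (a : nat) : (a < N)%nat -> F p <= - m 0%nat -> plow0 a <= p a.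
Proof.
  intros Ha Hp. destruct hpK as [HK Hmon].
  unfold p_low0. destruct (Rlt_dec _ _); [now apply HK|].
  apply HK; [lra|exact Ha].
Qed.

Lemma F_le (n a : nat) :
  (a < N)%nat -> m 0%nat <= W n a 0 -> F (fun b => P n b 0%nat) <= - m 0%nat.
Proof. intros Ha Hm. rewrite W_junction in Hm by exact Ha. lra. Qed.

(* The box is nondegenerate: if [pK (- m 0) a >= pup a], then the initial slope equals [pup a],
   and by continuity of [F] a slightly smaller slope stays below the level [- m 0 + 1]. *)
Lemma plow0_lt_pup (a : nat) : (a < N)%nat -> plow0 a < pup a.
Proof.
  intros Ha. unfold p_low0. destruct (Rlt_dec _ _) as [Hlt|Hge]; [exact Hlt|].
  set (p := fun b => P 0 b 0%nat).
  assert (HFp : F p <= - m 0%nat) by (apply F_le with a; [exact Ha|now apply m0_le_W]).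
  assert (Hpa : p a <= pup a) by (apply P_le_pup; [exact Ha|now apply m0_le_W]).
  destruct hF as (_ & [Hcont _] & _). destruct hpK as [HK _].
  destruct (Hcont p 1 Rlt_0_1) as [d [Hd Hclose]].
  assert (Hq : F (upd p a (p a - d / 2)) <= - m 0%nat + 1).
  { assert (Rabs (F (upd p a (p a - d / 2)) - F p) < 1) as Habs.
    { apply Hclose. apply nearN_upd; [now apply nearN_refl|].
      replace (p a - d / 2 - p a) with (- (d / 2)) by ring.
      rewrite Rabs_Ropp, Rabs_pos_eq; lra. }
    apply Rabs_def2 in Habs. lra. }
  apply HK with (a := a) in Hq; [|exact Ha]. rewrite upd_same in Hq. lra.
Qed.

Lemma Hplus_slope_m0 (a : nat) (p s : R) :
  (a < N)%nat -> 0 <= s -> Hplus H p0 a p + Lam * s <= - m 0%nat ->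
  Hplus H p0 a (p + s) <= Hplus H p0 a p + Lam * s.
Proof.
  intros Ha Hs Hps. destruct (bounds_level a) as (c & Hc & Hup & Hlow).
  pose proof (hH a Ha) as Hh.
  (* The equation at node 1 and time 0 shows that [- m 0] is at least the minimum of [H a]; hence
     [p0 a] lies above the lower end of the interval of the CFL condition. *)
  assert (Hmin : H a (p0 a) <= - m 0%nat).
  { pose proof (W_interior_le 0 a 0 Ha). pose proof (m0_le_W a 1 Ha). lra. }
  apply Hplus_slope with (- m 0%nat) c; try assumption.
  - exact Lam_pos.
  - intros x d Hx Hd. apply (proj1 hCFL a x d Ha); [|exact Hd].
    rewrite Hup, Hlow. split; [|lra]. apply Rle_trans with (p0 a); [|lra].
    apply pi_minus_le; [exact Hh|]. unfold Hminus. rewrite Rmin_left; lra.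
Qed.

Lemma Hminus_slope_m0 (a : nat) (p s : R) :
  (a < N)%nat -> 0 <= s -> Hminus H p0 a p + Lam * s <= - m 0%nat ->
  Hminus H p0 a (p - s) <= Hminus H p0 a p + Lam * s.
Proof.
  intros Ha Hs Hps. destruct (bounds_level a) as (c & Hc & Hup & Hlow).
  pose proof (hH a Ha) as Hh.
  assert (Hmin : H a (p0 a) <= - m 0%nat).
  { pose proof (W_interior_le 0 a 0 Ha). pose proof (m0_le_W a 1 Ha). lra. }
  apply Hminus_slope with (- m 0%nat) c; try assumption.
  - exact Lam_pos.
  - intros x d Hx Hd. apply (proj1 hCFL a x d Ha); [|exact Hd].
    rewrite Hup, Hlow. split; [lra|]. apply Rle_trans with (p0 a); [lra|].
    apply le_pi_plus; [exact Hh|]. unfold Hplus. rewrite Rmax_left; lra.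
Qed.

Lemma F_slope_m0 (p : nat -> R) (s : R) :
  (forall b, (b < N)%nat -> p b <= pup b) -> 0 <= s -> F p + Lam * s <= - m 0%nat ->
  F (shift p (- s)) <= F p + Lam * s.
Proof.
  intros Hpu Hs Hps. destruct hF as (_ & Hpc & _).
  apply (diagonal_slope N F plow0 pup Lam) with (- m 0%nat); try assumption.
  - exact Lam_pos.
  - exact plow0_lt_pup.
  - exact (proj2 hCFL).
  - intros q Hq b Hb. now apply plow0_le.
Qed.

Lemma F_nonincreasing (p q : nat -> R) : (forall b, (b < N)%nat -> p b <= q b) -> F q <= F p.
Proof.
  destruct hF as (Hdep & _ & Hdec & _). now apply nonincreasing_of_upd.
Qed.

Lemma Hplus_nondecreasing (a : nat) (p q : R) :
  (a < N)%nat -> p <= q -> Hplus H p0 a p <= Hplus H p0 a q.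
Proof. intros Ha. apply (clip_nondecreasing (H a)). now apply hH. Qed.

Lemma Hminus_nonincreasing (a : nat) (p q : R) :
  (a < N)%nat -> p <= q -> Hminus H p0 a q <= Hminus H p0 a p.
Proof.
  intros Ha Hpq. rewrite <- (Ropp_involutive p), <- (Ropp_involutive q), !Hminus_opp.
  apply (clip_nondecreasing (fun x => H a (- x))); [|lra]. now apply hyp_H_opp, hH.
Qed.

(** * Propagation of bounds on [W] in time *)

Lemma div_Lam_le (x y : R) : x <= y -> x / Lam <= y / Lam.
Proof.
  intros Hxy. apply Rmult_le_compat_r; [|exact Hxy].
  apply Rlt_le, Rinv_0_lt_compat, Lam_pos.
Qed.

Lemma Lam_mult_div (x : R) : Lam * (x / Lam) = x.
Proof. field. lra. Qed.

(** Put [Lam * s = W n a i - lb]. By [P_succ] each slope entering the equation at node [i] moves by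
    at most [s] in the direction that raises the Hamiltonian or [F]. The slope lemmas then allow a
    rise of at most [Lam * s], from a value at most [- W n a i] to one at most [- lb], and
    [- lb <= - m 0] is the level condition. *)
Lemma W_lower_step (n : nat) (lb : R) :
  m 0%nat <= lb -> (forall a i, (a < N)%nat -> lb <= W n a i) ->
  forall a i, (a < N)%nat -> lb <= W (S n) a i.
Proof.
  intros Hlb HW a i Ha.
  assert (Hm : forall a i, (a < N)%nat -> m 0%nat <= W n a i)
    by (intros b j Hb; specialize (HW b j Hb); lra).
  destruct i as [|i].
  - rewrite W_junction by exact Ha.
    set (p := fun b => P n b 0%nat). set (s := (W n a 0%nat - lb) / Lam).
    assert (HFp : F p = - W n a 0%nat) by (rewrite (W_junction n a Ha); unfold p; ring).
    assert (Hs : 0 <= s).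
    { unfold s. replace 0 with (0 / Lam) by (field; lra). apply div_Lam_le.
      specialize (HW a 0%nat Ha). lra. }
    assert (HLs : Lam * s = W n a 0%nat - lb) by (unfold s; apply Lam_mult_div).
    assert (F (shift p (- s)) <= F p + Lam * s).
    { apply F_slope_m0; [|exact Hs|lra]. intros b Hb. apply P_le_pup; auto. }
    assert (F (fun b => P (S n) b 0%nat) <= F (shift p (- s))); [|lra].
    apply F_nonincreasing. intros b Hb. unfold shift, p, s. rewrite P_succ.
    (* [W] has a common value at the junction, so one [s] bounds the decrease of all junction
       slopes; this is why only diagonal shifts of [F] occur. *)
    replace (W n b 0%nat) with (W n a 0%nat)
      by (rewrite !W_junction by assumption; reflexivity).
    enough ((lb - W n a 0%nat) / Lam <= (W n b 1%nat - W n a 0%nat) / Lam).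
    { replace (- ((W n a 0%nat - lb) / Lam)) with ((lb - W n a 0%nat) / Lam) by (field; lra).
      lra. }
    apply div_Lam_le. specialize (HW b 1%nat Hb). lra.
  - rewrite W_interior.
    enough (Rmax (Hplus H p0 a (P (S n) a i)) (Hminus H p0 a (P (S n) a (S i))) <= - lb) by lra.
    pose proof (W_interior n a i) as HWi.
    pose proof (Rmax_l (Hplus H p0 a (P n a i)) (Hminus H p0 a (P n a (S i)))) as Hl.
    pose proof (Rmax_r (Hplus H p0 a (P n a i)) (Hminus H p0 a (P n a (S i)))) as Hr.
    set (s := (W n a (S i) - lb) / Lam).
    assert (Hs : 0 <= s).
    { unfold s. replace 0 with (0 / Lam) by (field; lra). apply div_Lam_le.
      specialize (HW a (S i) Ha). lra. }
    assert (HLs : Lam * s = W n a (S i) - lb) by (unfold s; apply Lam_mult_div).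
    apply Rmax_lub.
    + apply Rle_trans with (Hplus H p0 a (P n a i + s)).
      * apply Hplus_nondecreasing; [exact Ha|]. rewrite P_succ. apply Rplus_le_compat_l.
        apply div_Lam_le. specialize (HW a i Ha). lra.
      * eapply Rle_trans; [apply Hplus_slope_m0; try assumption; lra|lra].
    + apply Rle_trans with (Hminus H p0 a (P n a (S i) - s)).
      * apply Hminus_nonincreasing; [exact Ha|]. rewrite P_succ.
        enough ((lb - W n a (S i)) / Lam <= (W n a (S (S i)) - W n a (S i)) / Lam).
        { unfold s.
          replace ((W n a (S i) - lb) / Lam) with (- ((lb - W n a (S i)) / Lam)) by (field; lra).
          lra. }
        apply div_Lam_le. specialize (HW a (S (S i)) Ha). lra.
      * eapply Rle_trans; [apply Hminus_slope_m0; try assumption; lra|lra].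
Qed.

(** The comparison is run backwards, from the slopes at time [n + 1] to those at time [n]. Assuming
    [W (S n) a i > ub] supplies the level condition, since the new value plus [Lam * s] is then
    below [- W n a i <= - m 0]; the old value would lie strictly below [- W n a i], which it
    equals. *)
Lemma W_upper_step (n : nat) (ub : R) :
  (forall a i, (a < N)%nat -> m 0%nat <= W n a i) ->
  (forall a i, (a < N)%nat -> m 0%nat <= W (S n) a i) ->
  (forall a i, (a < N)%nat -> W n a i <= ub) ->
  forall a i, (a < N)%nat -> W (S n) a i <= ub.
Proof.
  intros Hm HmS HW a i Ha. apply Rnot_lt_le. intros Hlt.
  specialize (Hm a i Ha). pose proof (HW a i Ha) as HWa.
  set (s := (ub - W n a i) / Lam).
  assert (Hs : 0 <= s).
  { unfold s. replace 0 with (0 / Lam) by (field; lra). apply div_Lam_le. lra. }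
  assert (HLs : Lam * s = ub - W n a i) by (unfold s; apply Lam_mult_div).
  destruct i as [|i].
  - rewrite W_junction in Hlt by exact Ha. unfold s in *. clear s.
    set (s := (ub - W n a 0%nat) / Lam) in *.
    set (p := fun b => P (S n) b 0%nat) in *.
    assert (F (shift p (- s)) <= F p + Lam * s).
    { apply F_slope_m0; [|exact Hs|lra]. intros b Hb. apply P_le_pup; auto. }
    assert (F (fun b => P n b 0%nat) <= F (shift p (- s))).
    { apply F_nonincreasing. intros b Hb. unfold shift, p, s. rewrite P_succ.
      replace (W n b 0%nat) with (W n a 0%nat)
        by (rewrite !W_junction by assumption; reflexivity).
      enough ((W n b 1%nat - W n a 0%nat) / Lam <= (ub - W n a 0%nat) / Lam) by lra.
      apply div_Lam_le. specialize (HW b 1%nat Hb). lra. }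
    rewrite (W_junction n a Ha) in HLs. lra.
  - rewrite W_interior in Hlt. rewrite W_interior in HLs.
    pose proof (Rmax_l (Hplus H p0 a (P (S n) a i)) (Hminus H p0 a (P (S n) a (S i)))) as Hl.
    pose proof (Rmax_r (Hplus H p0 a (P (S n) a i)) (Hminus H p0 a (P (S n) a (S i)))) as Hr.
    rewrite W_interior in Hm.
    (* Only the term attaining the maximum at time [n] is compared, as it is the one equal to
       [- W n a (S i)]. *)
    destruct (Rmax_case_strong (Hplus H p0 a (P n a i)) (Hminus H p0 a (P n a (S i)))
      (fun r => r = Hplus H p0 a (P n a i) \/ r = Hminus H p0 a (P n a (S i)))) as [Heq|Heq];
      [now left|now right| |]; rewrite Heq in HLs, Hm.
    + assert (Hplus H p0 a (P n a i) <= Hplus H p0 a (P (S n) a i + s)).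
      { apply Hplus_nondecreasing; [exact Ha|]. rewrite P_succ.
        enough ((W n a (S i) - ub) / Lam <= (W n a (S i) - W n a i) / Lam).
        { unfold s.
          replace ((ub - W n a (S i)) / Lam) with (- ((W n a (S i) - ub) / Lam)) by (field; lra).
          lra. }
        apply div_Lam_le. specialize (HW a i Ha). lra. }
      assert (Hplus H p0 a (P (S n) a i + s) <= Hplus H p0 a (P (S n) a i) + Lam * s).
      { apply Hplus_slope_m0; try assumption. lra. }
      lra.
    + assert (Hminus H p0 a (P n a (S i)) <= Hminus H p0 a (P (S n) a (S i) - s)).
      { apply Hminus_nonincreasing; [exact Ha|]. rewrite P_succ.
        enough ((W n a (S (S i)) - W n a (S i)) / Lam <= (ub - W n a (S i)) / Lam)
          by (unfold s; lra).
        apply div_Lam_le. specialize (HW a (S (S i)) Ha). lra. }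
      assert (Hminus H p0 a (P (S n) a (S i) - s) <= Hminus H p0 a (P (S n) a (S i)) + Lam * s).
      { apply Hminus_slope_m0; try assumption. lra. }
      lra.
Qed.

Lemma m0_le (n a i : nat) : (a < N)%nat -> m 0%nat <= W n a i.
Proof.
  revert a i. induction n as [|n IH]; intros a i Ha; [now apply m0_le_W|].
  now apply (W_lower_step n (m 0%nat)); [lra| |].
Qed.

Lemma W_bounded_above (n : nat) : exists ub, forall a i, (a < N)%nat -> W n a i <= ub.
Proof.
  induction n as [|n [ub IH]].
  - (* The common upper bound is obtained as the inverse of a common radius. *)
    destruct (finite_radius N (fun a r => - H a (p0 a) <= / r)) as [r [Hr Hub]].
    + intros a d d' Hd Ha. eapply Rle_trans; [exact Ha|]. apply Rinv_le_contravar; lra.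
    + intros a Ha. exists (/ (Rabs (H a (p0 a)) + 1)).
      pose proof (Rabs_pos (H a (p0 a))).
      split; [apply Rinv_0_lt_compat; lra|].
      rewrite Rinv_inv. pose proof (Rle_abs (- H a (p0 a))) as Habs.
      rewrite Rabs_Ropp in Habs. lra.
    + exists (Rmax (/ r) (W 0 0%nat 0%nat)). intros a [|i] Ha.
      * rewrite (W_junction 0 a Ha), (W_junction 0 0) by lia. apply Rmax_r.
      * eapply Rle_trans; [now apply W_interior_le|].
        eapply Rle_trans; [now apply Hub|apply Rmax_l].
  - exists ub. apply W_upper_step; [|exact (m0_le (S n))|exact IH]. exact (m0_le n).
Qed.

(** * Monotonicity of the extrema of [W] *)

Lemma m_le_W (n a i : nat) : (a < N)%nat -> m n <= W n a i.
Proof.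
  intros Ha. apply Rinf_lb with (m 0%nat); [|now exists a, i].
  intros y (b & j & Hb & ->). now apply m0_le.
Qed.

Lemma le_m (n : nat) (lb : R) : (forall a i, (a < N)%nat -> lb <= W n a i) -> lb <= m n.
Proof.
  (* Branch 0 exists because [N >= 1], so the set is nonempty and [Rinf] is a true infimum. *)
  intros Hlb. apply Rinf_ge with (W n 0%nat 0%nat); [now exists 0%nat, 0%nat|].
  intros y (b & j & Hb & ->). now apply Hlb.
Qed.

Lemma W_le_M (n a i : nat) : (a < N)%nat -> W n a i <= M n.
Proof.
  intros Ha. destruct (W_bounded_above n) as [ub Hub].
  apply Rsup_ub with ub; [|now exists a, i].
  intros y (b & j & Hb & ->). now apply Hub.
Qed.

Lemma M_le (n : nat) (ub : R) : (forall a i, (a < N)%nat -> W n a i <= ub) -> M n <= ub.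
Proof.
  intros Hub. apply Rsup_le with (W n 0%nat 0%nat); [now exists 0%nat, 0%nat|].
  intros y (b & j & Hb & ->). now apply Hub.
Qed.

Lemma m_nondecreasing (n : nat) : m n <= m (S n).
Proof.
  apply le_m, W_lower_step.
  - apply le_m. exact (m0_le n).
  - exact (m_le_W n).
Qed.

Lemma M_nonincreasing (n : nat) : M (S n) <= M n.
Proof.
  apply M_le, W_upper_step; [exact (m0_le n)|exact (m0_le (S n))|exact (W_le_M n)].
Qed.

Lemma M_le_M0 (n : nat) : M n <= M 0%nat.
Proof.
  induction n as [|n IH]; [lra|]. pose proof (M_nonincreasing n). lra.
Qed.
End Gradient.

Theorem theorem3p1
  (N : nat) (HN : (1 <= N)%nat)
  (H : nat -> R -> R) (p0 : nat -> R)
  (hH : forall a, (a < N)%nat -> hyp_H (H a) (p0 a))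
  (F : (nat -> R) -> R) (hF : hyp_F N F)
  (pK : R -> nat -> R) (hpK : hyp_pK N F pK)
  (u0 : nat -> R -> R) (hu0 : lipschitz_J N u0)
  (dt dx : R) (hdt : 0 < dt) (hdx : 0 < dx)
  (hm0 : exists lb, forall a i, (a < N)%nat -> lb <= Wd H p0 F u0 dt dx 0 a i)
  (hCFL : CFLr H p0 F u0 dt dx pK N) :
  forall n : nat,
    (* (i) *)
    ((forall a i, (a < N)%nat -> (1 <= i)%nat ->
        p_low H p0 F u0 dt dx N a <= pplus H p0 F u0 dt dx n a i <= p_up H p0 F u0 dt dx N a) /\
     (forall a, (a < N)%nat ->
        p_low0 H p0 F u0 dt dx pK N a <= pplus H p0 F u0 dt dx n a 0 <= p_up H p0 F u0 dt dx N a)) /\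
    (* (ii): the infima/suprema are finite and ordered *)
    ((exists lb, forall a i, (a < N)%nat -> lb <= Wd H p0 F u0 dt dx n a i) /\
     (exists ub, forall a i, (a < N)%nat -> Wd H p0 F u0 dt dx n a i <= ub) /\
     mn H p0 F u0 dt dx N 0 <= mn H p0 F u0 dt dx N n /\
     mn H p0 F u0 dt dx N n <= mn H p0 F u0 dt dx N (S n) /\
     mn H p0 F u0 dt dx N (S n) <= Mn H p0 F u0 dt dx N (S n) /\
     Mn H p0 F u0 dt dx N (S n) <= Mn H p0 F u0 dt dx N n /\
     Mn H p0 F u0 dt dx N n <= Mn H p0 F u0 dt dx N 0).
Proof.
  intros n.
  assert (Hm : forall k a i, (a < N)%nat ->
            mn H p0 F u0 dt dx N 0 <= Wd H p0 F u0 dt dx k a i)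
    by (intros; eapply m0_le; eassumption).
  split; [split|].
  - intros a [|i] Ha Hi; [lia|]. split; [eapply plow_le_P|eapply P_le_pup]; eauto.
  - intros a Ha. split.
    + apply (plow0_le N H p0 F pK hpK u0 dt dx (fun b => pplus H p0 F u0 dt dx n b 0));
        [exact Ha|].
      eapply F_le; eauto.
    + eapply P_le_pup; eauto.
  - repeat split.
    + exists (mn H p0 F u0 dt dx N 0). intros; now apply Hm.
    + eapply W_bounded_above; eassumption.
    + eapply le_m; eauto.
    + eapply m_nondecreasing; eassumption.
    (* Any single value of [W] lies between the infimum and the supremum; the junction value of
       branch 0 serves. *)
    + apply Rle_trans with (Wd H p0 F u0 dt dx (S n) 0 0).
      * eapply m_le_W; eassumption.
      * eapply W_le_M; eassumption.
    + eapply M_nonincreasing; eassumption.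
    + eapply M_le_M0; eassumption.
Qed.
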